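(* Let $d\ge 1$ and let $f\in C^{d+2}([0,1];\mathbf{R}^d)$ be such that, for every $v\in[0,1]$, the set $\{f''(v),f'''(v),\dots,f^{(d+1)}(v)\}$ of the derivatives of $f$ of orders $2,\dots,d+1$ at $v$ spans $\mathbf{R}^d$. Let $g\in L^\infty(\mathbf{R}\times\mathbf{R}^d)$ and let $u\in C(\mathbf{R}\times\mathbf{R}^d;[0,1])$ be a continuous and isentropic solution of the scalar balance law $\partial_t u+\mathrm{div}_x f(u)=g$. Then, for any $t\in\mathbf{R}$, the function $u(t,\cdot)$ is $\overline{\gamma}$-Hölder continuous in space with $$\overline{\gamma}=\frac{1}{2d}.$$
   Context: Solutions are understood in the sense of distributions on $\mathbf{R}\times\mathbf{R}^d$, with $t\in\mathbf{R}$ and $x\in\mathbf{R}^d$. A continuous solution $u$ with values in $[0,1]$ is isentropic if for every entropy-entropy flux pair $(\eta,q)$ (that is, $\eta$ is convex and differentiable and $q'(v)=\eta'(v)f'(v)$ for every $v$, with $q$ taking values in $\mathbf{R}^d$) one has $\partial_t\eta(u)+\mathrm{div}_x q(u)=\eta'(u)\,g$ in the sense of distributions. *)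

(* Defs.v *)
From HB Require Import structures.
From mathcomp Require Import all_boot all_order all_algebra.
From mathcomp Require Import all_classical all_reals all_analysis.

Set Implicit Arguments.
Unset Strict Implicit.
Unset Printing Implicit Defensive.

Import Order.TTheory GRing.Theory Num.Theory.
Import numFieldNormedType.Exports.

Local Open Scope classical_set_scope.
Local Open Scope ring_scope.

Definition rV_display : measure_display. Proof. exact. Qed.

(* The product sigma-algebra on R^n, i.e. the Borel sets. *)
Section measurable_rV.
Context {R : realType} (n : nat).

Definition rV_coord (i : 'I_n) (x : 'rV[R]_n) : measurableTypeR R := x ord0 i.

Definition measurable_rV : set (set 'rV[R]_n) := g_sigma_preimage rV_coord.

Let measurable_rV0 : measurable_rV set0.
Proof. exact: sigma_algebra0. Qed.

Let measurable_rVC A : measurable_rV A -> measurable_rV (~` A).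
Proof. exact: sigma_algebraC. Qed.

Let measurable_rV_bigcup (F : (set 'rV[R]_n)^nat) :
  (forall i, measurable_rV (F i)) -> measurable_rV (\bigcup_i (F i)).
Proof. exact: sigma_algebra_bigcup. Qed.

HB.instance Definition _ := @isMeasurable.Build rV_display
  'rV[R]_n measurable_rV measurable_rV0 measurable_rVC measurable_rV_bigcup.

End measurable_rV.

Lemma measurable_rV_coord (R : realType) n (i : 'I_n) :
  measurable_fun [set: 'rV[R]_n] (@rV_coord R n i).
Proof.
move=> _ Y mY; rewrite setTI; apply: sub_sigma_algebra => /=.
rewrite -bigcup_seq/=; exists i => /=; first by rewrite mem_index_enum.
by exists Y => //; rewrite setTI.
Qed.

Lemma measurable_fun_rV (d : measure_display) (T : measurableType d)
    (R : realType) n (h : T -> 'rV[R]_n) :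
  (forall i, measurable_fun [set: T] (@rV_coord R n i \o h)) ->
  measurable_fun [set: T] h.
Proof.
move=> mh; pose G : set (set 'rV[R]_n) :=
  \big[setU/set0]_(i < n) preimage_set_system setT (@rV_coord R n i) measurable.
apply: (@measurability _ _ _ _ _ _ G) => // _ [B + <-].
rewrite /G -bigcup_seq => -[i _ [Y mY <-]] /=.
by have := mh i measurableT Y mY; rewrite !setTI.
Qed.

Section rV_cons.
Context {R : realType} (n : nat).

Definition rV_cons (p : measurableTypeR R * 'rV[R]_n) : 'rV[R]_n.+1 :=
  row_mx (p.1)%:M p.2.

Lemma rV_cons0 p : rV_cons p ord0 ord0 = p.1.
Proof.
by rewrite /rV_cons mxE; case: splitP => [j _|j /eqP//];
rewrite !ord1 mxE /= mulr1n.
Qed.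

Lemma rV_consS p i : rV_cons p ord0 (lift ord0 i) = p.2 ord0 i.
Proof.
rewrite /rV_cons mxE; case: splitP => [j|j /eqP]; first by rewrite ord1.
by rewrite /= /bump /= eqSS => /eqP ij; congr (p.2 _ _); exact: val_inj.
Qed.

Lemma measurable_rV_cons : measurable_fun setT rV_cons.
Proof.
apply: measurable_fun_rV => i.
case: (unliftP ord0 i) => [j ->|->].
- rewrite (_ : _ \o _ = rV_coord j \o snd).
    by apply: measurableT_comp; [exact: measurable_rV_coord|].
  by apply/funext => p /=; rewrite /rV_coord rV_consS.
- rewrite (_ : _ \o _ = fst); first exact: measurable_fst.
  by apply/funext => p /=; rewrite /rV_coord rV_cons0.
Qed.

Let rV_uncons (y : 'rV[R]_n.+1) : measurableTypeR R * 'rV[R]_n :=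
  (y ord0 ord0, \row_i y ord0 (lift ord0 i)).

Lemma rV_cons_sigma_finite (mu : set (measurableTypeR R * 'rV[R]_n) -> \bar R) :
  sigma_finite setT mu -> sigma_finite setT (pushforward mu rV_cons).
Proof.
move=> [F TF mF]; have mU : measurable_fun setT rV_uncons.
  apply/measurable_fun_pair; first exact: measurable_rV_coord.
  apply: measurable_fun_rV => i.
  rewrite (_ : _ \o _ = rV_coord (lift ord0 i)); first exact: measurable_rV_coord.
  by apply/funext => y; rewrite /= /rV_coord mxE.
have consK p : rV_uncons (rV_cons p) = p.
  rewrite /rV_uncons rV_cons0 [RHS]surjective_pairing; congr pair.
  by apply/rowP => i; rewrite mxE rV_consS.
exists (fun k => rV_uncons @^-1` F k).
  by rewrite -preimage_bigcup -TF preimage_setT.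
move=> k; have [mFk Fkoo] := mF k; split.
  by rewrite -[X in measurable X]setTI; exact: mU.
rewrite /pushforward -comp_preimage (_ : rV_uncons \o rV_cons = id) //.
by apply/funext => p /=; rewrite consK.
Qed.

End rV_cons.

Section rV_cons_measure.
Local Open Scope ereal_scope.
Context {R : realType} (n : nat).
Variable m : {sigma_finite_measure set 'rV[R]_n -> \bar R}.

Definition rV_cons_measure : set 'rV[R]_n.+1 -> \bar R :=
  pushforward (lebesgue_measure \x m) (@rV_cons R n).

Let mcons A : measurable A -> measurable (@rV_cons R n @^-1` A).
Proof.
by move=> mA; rewrite -[X in measurable X]setTI; exact: measurable_rV_cons.
Qed.

Let rV_cons_measure0 : rV_cons_measure set0 = 0.
Proof. by rewrite /rV_cons_measure /pushforward preimage_set0 measure0. Qed.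

Let rV_cons_measure_ge0 A : 0 <= rV_cons_measure A.
Proof. exact: (measure_ge0 (lebesgue_measure \x m)). Qed.

Let rV_cons_measure_sigma_additive : semi_sigma_additive rV_cons_measure.
Proof.
move=> F mF tF mUF; rewrite /rV_cons_measure /pushforward preimage_bigcup.
apply: measure_semi_sigma_additive.
- by move=> k; exact: mcons.
- apply/trivIsetP => /= i j _ _ ij; rewrite -preimage_setI.
  by move/trivIsetP : tF => /(_ _ _ _ _ ij) ->//; rewrite preimage_set0.
- by rewrite -preimage_bigcup; exact: mcons.
Qed.

HB.instance Definition _ := isMeasure.Build _ _ _ rV_cons_measure
  rV_cons_measure0 rV_cons_measure_ge0 rV_cons_measure_sigma_additive.

Let rV_cons_measure_sigma_finite : sigma_finite setT rV_cons_measure.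
Proof.
apply: rV_cons_sigma_finite.
have /sigma_finiteP[F [TF ndF Foo]] := sigma_finiteT (@lebesgue_measure R).
have /sigma_finiteP[G [TG ndG Goo]] := sigma_finiteT m.
exists (fun k => F k `*` G k).
  rewrite -setXTT TF TG predeqE => -[x y]; split.
    move=> [/= [k _ Fkx] [l _ Gly]]; exists (maxn k l) => //; split.
    - by move: x Fkx; exact/subsetPset/ndF/leq_maxl.
    - by move: y Gly; exact/subsetPset/ndG/leq_maxr.
  by move=> [k _ []/= ? ?]; split; exists k.
move=> k; have [? ?] := Foo k; have [? ?] := Goo k.
split; first exact: measurableX.
by rewrite product_measure1E// lte_mul_pinfty// ge0_fin_numE.
Qed.

HB.instance Definition _ := Measure_isSigmaFinite.Build _ _ _ rV_cons_measure
  rV_cons_measure_sigma_finite.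

End rV_cons_measure.

(* Lebesgue measure on R^n: the n-fold product of the one-dimensional one. *)
Fixpoint lebesgue_rV (R : realType) n :
    {sigma_finite_measure set 'rV[R]_n -> \bar R} :=
  match n with
  | 0 => [the sigma_finite_measure _ _ of \d_(0 : 'rV[R]_0)]
  | n'.+1 => [the sigma_finite_measure _ _ of rV_cons_measure (lebesgue_rV R n')]
  end.

Definition lebesgue_spacetime (R : realType) d :
  {measure set (measurableTypeR R * 'rV[R]_d) -> \bar R} :=
  (lebesgue_measure \x lebesgue_rV R d)%E.

(* Derivatives of functions that are only meaningful on D: x tends to a inside
   D \ {a}. With D = [0, 1] they are one-sided at the endpoints, and the values
   of f outside D play no role. *)
Section derive_in.
Context {R : realType} {V : normedModType R}.
Implicit Types (D : set R) (f : R -> V).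

Definition derivable_in D f (a : R) : Prop :=
  cvg ((fun x => (x - a)^-1 *: (f x - f a)) @ within D a^').

Definition derive1_in D f (a : R) : V :=
  lim ((fun x => (x - a)^-1 *: (f x - f a)) @ within D a^').

Definition derive1n_in D n f : R -> V := iter n (derive1_in D) f.

Definition Ck_in D k f : Prop :=
  (forall j, (j < k)%N -> forall a, D a -> derivable_in D (derive1n_in D j f) a)
  /\ (forall j, (j <= k)%N -> {within D, continuous (derive1n_in D j f)}).

End derive_in.

(* Ck k phi: the iterated directional derivatives of phi up to order k, in all
   directions, exist and are continuous. *)
Section test_functions.
Context {R : realType} {V : normedModType R}.

Fixpoint Ck (k : nat) (phi : V -> R) : Prop :=
  continuous phi /\
  if k is k'.+1 then
    forall v, (forall x, derivable phi x v) /\ Ck k' ('D_v phi)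
  else True.

Definition test_function (phi : V -> R) : Prop :=
  (forall k, Ck k phi) /\ compact (closure [set x | phi x != 0]).

End test_functions.

Definition unit_interval {R : realType} : set R := [set v | 0 <= v <= 1].

Section balance_law.
Context {R : realType} {d : nat}.
Implicit Types (f q : R -> 'rV[R]_d) (g u : R * 'rV[R]_d -> R).

Definition dt (phi : R * 'rV[R]_d -> R) : R * 'rV[R]_d -> R := 'D_(1, 0) phi.

Definition dx (i : 'I_d) (phi : R * 'rV[R]_d -> R) : R * 'rV[R]_d -> R :=
  'D_(0, delta_mx ord0 i) phi.

(* d_t a + div_x b = h in the sense of distributions on R x R^d *)
Definition distributional_balance (a : R * 'rV[R]_d -> R)
    (b : R * 'rV[R]_d -> 'rV[R]_d) (h : R * 'rV[R]_d -> R) : Prop :=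
  forall phi, test_function phi ->
  - (\int[lebesgue_spacetime R d]_z
       (a z * dt phi z + \sum_(i < d) b z ord0 i * dx i phi z)) =
  \int[lebesgue_spacetime R d]_z (h z * phi z).

Definition distributional_solution f g u : Prop :=
  distributional_balance u (f \o u) g.

Definition entropy_pair f (eta : R -> R) q : Prop :=
  @convex_function R R^o (@unit_interval R) eta /\
  forall v, 0 <= v <= 1 ->
    [/\ derivable_in (@unit_interval R) (eta : R -> R^o) v,
        derivable_in (@unit_interval R) q v &
        derive1_in (@unit_interval R) q v =
          derive1_in (@unit_interval R) (eta : R -> R^o) v *: derive1_in (@unit_interval R) f v].

(* entropy_pair only involves eta and q on [0, 1], the range of u. *)
Definition isentropic f g u : Prop :=
  forall eta q, entropy_pair f eta q ->
  distributional_balance (eta \o u) (q \o u)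
    (fun z => derive1_in (@unit_interval R) (eta : R -> R^o) (u z) * g z).

End balance_law.

(* On 'rV[R]_d the norm is the sup norm; the Euclidean norm yields the same
   notion with another constant C. *)
Definition holder_continuous (R : realType) (V : normedModType R)
    (gamma : R) (h : V -> R) : Prop :=
  exists C : R, forall x y, `|h x - h y| <= C * `|x - y| `^ gamma.

(* Main.v *)
Require Import Defs.
From mathcomp Require Import all_boot all_order all_algebra ring lra.
From mathcomp Require Import all_classical all_reals all_analysis.
From mathcomp Require Import measurable_realfun ess_sup_inf.

(* If u > w at (t, x), then at time t + r the set {u > w - K |r|} still meets the
   ball of radius C r^2 around x + r f'(w): entropies whose derivative is
   concentrated just below w, tested against an exponentially weighted function
   supported in a cube moving with velocity f'(w), propagate this information in
   both directions of time. Moving for a time s with velocity f'(w') and back with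
   velocity f'(w'') therefore leads from a point of {u(t, .) > w'} to a point of
   {u(t, .) > w''} displaced by s (f'(w') - f'(w'')) + O(s^2). By the spanning
   condition the increments of f' over a grid of d + 1 values with step h span
   R^d, with a constant of order h^-d; a displacement of length r hence takes
   times s of order r h^-d, and the error s^2 is a small fraction of r as soon as
   r << h^(2d). Iterating, a point with u(t, .) = a + del at distance << del^(2d)
   from a point x1 with u(t, x1) = a yields points tending to x1 at which
   u(t, .) > a + del / 2, against the continuity of u. *)

Set Implicit Arguments.
Unset Strict Implicit.
Unset Printing Implicit Defensive.

Import Order.TTheory GRing.Theory Num.Theory.
Import numFieldNormedType.Exports.

Local Open Scope classical_set_scope.
Local Open Scope ring_scope.

(** * Smooth test functions *)

(** The rising part of [k] therefore solves an exponential equation of rate [m], which bounds [k] by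
    [m * N] plus a constant; a weight in time of rate [lam = m * G] swallows the first part. Over a
    drop of level [4 * G * tau] the entropy reaches the order of [exp (4 * lam * tau)], the weight
    varies only by about [exp (2 * lam * tau)], and a large [lam] decides. Equality in the entropy
    balance matters twice: a bump is a difference of two nondecreasing functions, each the
    derivative of a convex entropy, and the sign [sg] of time is free. *)

Section flat_functions.
Context {R : realType}.
Implicit Types (p : {poly R}) (x y c : R).

(** The polynomial factor makes the family stable under differentiation: for [x > 0] the derivative
    of [p(1/x) exp(-1/x)] has the same form, with polynomial [X^2 (p - p')]. All derivatives of
    [exp(-1/x)] are thus handled at once. *)
Definition flat p x : R := if 0 < x then p.[x^-1] * expR (- x^-1) else 0.

Lemma horner_expR_bounded p c : 0 < c ->
  exists C, forall y, 0 <= y -> `|p.[y]| * expR (- (c * y)) <= C.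
Proof.
elim/poly_ind: p c => [|p a IH] c c0.
  by exists 0 => y y0; rewrite horner0 normr0 mul0r.
have c20 : 0 < c / 2 by rewrite divr_gt0.
have [C HC] := IH _ c20.
exists (C * (2 / c) + `|a|) => y y0; have cy : 0 <= c * y by rewrite mulr_ge0// ltW.
rewrite hornerMXaddC.
have E0 : 0 <= expR (- (c * y)) by exact: expR_ge0.
have E1 : expR (- (c * y)) <= 1 by rewrite -[leRHS]expR0 ler_expR oppr_le0.
apply: le_trans (_ : (`|p.[y]| * y + `|a|) * expR (- (c * y)) <= _).
  by rewrite ler_wpM2r// (le_trans (ler_normD _ _))// normrM (ger0_norm y0).
rewrite mulrDl; apply: lerD; last first.
  by rewrite -[leRHS]mulr1 ler_wpM2l.
(* One half of the exponential pays for [p] by induction, which is why [c] varies in the induction;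
   the other half pays for the extra factor [y]. *)
have -> : - (c * y) = - (c / 2 * y) + - (c / 2 * y) by field.
rewrite expRD mulrACA; apply: ler_pM; [|exact: mulr_ge0 (expR_ge0 _)| exact: HC|].
- exact: mulr_ge0 (expR_ge0 _).
- rewrite expRN ler_pdivrMr ?expR_gt0//.
  have := expR_ge1Dx (c / 2 * y) => h.
  apply: le_trans (_ : 2 / c * (c / 2 * y) <= _).
    by rewrite mulrA (_ : 2 / c * (c / 2) = 1) ?mul1r//; field; lra.
  rewrite ler_wpM2l ?divr_ge0//; first exact: ltW.
  by apply: le_trans h; lra.
Qed.

Lemma flat_le0 p x : x <= 0 -> flat p x = 0.
Proof. by move=> x0; rewrite /flat ltNge x0. Qed.

Lemma flat_linear_bound p : exists2 C, 0 <= C & forall x, `|flat p x| <= C * `|x|.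
Proof.
have [C HC] := horner_expR_bounded (p * 'X) (@ltr01 R).
have C0 : 0 <= C by apply: le_trans (HC 0 _) => //; rewrite mulr_ge0// expR_ge0.
exists C => // x; rewrite /flat; case: ifPn => x0; last first.
  by rewrite normr0 mulr_ge0.
rewrite normrM (ger0_norm (expR_ge0 _)) -ler_pdivrMr ?normr_gt0 ?gt_eqF//.
have xi : 0 <= x^-1 by rewrite invr_ge0 ltW.
have := HC _ xi; rewrite hornerMX mul1r normrM (ger0_norm xi).
by rewrite (gtr0_norm x0) -!mulrA [x^-1 * _]mulrC.
Qed.

Lemma is_derive_flat p x :
  is_derive x 1 (flat p) (flat ('X^2 * (p - p^`())) x).
Proof.
have [x0|x0|->] := ltgtP x 0.
- have zd := @is_derive_cst _ R R 0 x 1.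
  rewrite flat_le0 ?ltW//; apply: near_eq_is_derive zd.
  by near=> z; rewrite flat_le0//; near: z; exact: lt_le_nbhsl.
- have xn0 : x != 0 by rewrite gt_eqF.
  have di : is_derive x 1 (fun y : R => y^-1) (- x ^- 2 *: 1) by exact: is_deriveV.
  have dp : is_derive x^-1 1 (horner p) (p^`().[x^-1]).
    apply: DeriveDef; first exact: derivable_horner.
    by rewrite derivE derive1E.
  have de : is_derive x 1 (expR \o (fun y : R => - y^-1)) (expR (- x^-1) * - (- x ^-
    2 *: 1)).
    by apply: is_derive1_comp; exact: is_deriveN.
  have dpi := @is_derive1_comp _ _ _ _ _ _ dp di.
  have := is_deriveM dpi de => /= dm.
  apply: (@near_eq_is_derive _ _ _ ((horner p \o (fun y : R => y^-1)) * (expR \o (fun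
    y : R => - y^-1)))) => //.
    near=> z; rewrite /flat ifT//; near: z; exact: lt_nbhsr.
  apply: is_derive_eq; rewrite /flat x0 !hornerE /GRing.scale /= ?exprVn.
  by ring.
- rewrite flat_le0//.
  have [C C0 HC] := flat_linear_bound ('X * p).
  (* The difference quotient at 0 is thus [flat ('X * p)] itself, which the linear bound sends to
     0. *)
  have flatX t : flat p t = t * flat ('X * p) t.
    rewrite /flat; case: ifPn => t0; last by rewrite mulr0.
    by rewrite hornerM hornerX !mulrA divff ?mul1r// gt_eqF.
  have H : (fun h : R => h^-1 *: (flat p (h *: 1 + 0) - flat p 0)) @ 0^' --> (0 : R).
    apply/cvgrPdist_le => e e0; near=> h.
    rewrite sub0r normrN (flat_le0 p (lexx 0)) subr0 addr0 [h%:A]mulr1.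
    have h0 : h != 0 by near: h; exact: nbhs_dnbhs_neq.
    rewrite flatX /GRing.scale/= mulKf//.
    apply: (le_trans (HC h)); apply: (@le_trans _ _ ((C + 1) * `|h|)).
      by rewrite ler_wpM2r// lerDl.
    rewrite -ler_pdivlMl ?ltr_wpDl// mulrC; apply: ltW; near: h.
    by apply: dnbhs0_lt; rewrite divr_gt0// ltr_wpDl.
  by apply: DeriveDef; [exact: (cvgP _ H)|exact: (cvg_lim _ H)].
Unshelve. all: by end_near. Qed.

(** The [n]-th derivative of [exp(-1/x)] extended by 0. The index makes it a sequence of successive
    derivatives, the form in which [Ck_comp_affine] takes its argument. *)
Definition cutoff (n : nat) : R -> R :=
  flat (iter n (fun p => 'X^2 * (p - p^`())) 1).

Lemma is_derive_cutoff n x : is_derive x 1 (cutoff n) (cutoff n.+1 x).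
Proof. exact: is_derive_flat. Qed.

Lemma continuous_cutoff n : continuous (cutoff n).
Proof.
move=> x; have [D _] := is_derive_cutoff n x.
exact/differentiable_continuous/derivable1_diffP.
Qed.

Lemma cutoff_le0 n x : x <= 0 -> cutoff n x = 0.
Proof. exact: flat_le0. Qed.

Lemma cutoff0E x : 0 < x -> cutoff 0 x = expR (- x^-1).
Proof. by move=> x0; rewrite /cutoff /flat x0 /= hornerC mul1r. Qed.

(** At distance at least [eps] from 0 the derivative of the cutoff is therefore at most [eps ^- 2]
    times the cutoff; the closing edge of the time window is absorbed this way. *)
Lemma cutoff1E x : 0 < x -> cutoff 1 x = x ^- 2 * cutoff 0 x.
Proof.
move=> x0; rewrite cutoff0E// /cutoff /flat x0 /= derivC subr0 mulr1.
by rewrite hornerXn exprVn.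
Qed.

Lemma cutoff0_gt0 x : 0 < x -> 0 < cutoff 0 x.
Proof. by move=> x0; rewrite cutoff0E// expR_gt0. Qed.

Lemma cutoff0_ge0 x : 0 <= cutoff 0 x.
Proof. by have [/cutoff_le0->|/cutoff0_gt0/ltW] := leP x 0. Qed.

Lemma cutoff0_le1 x : cutoff 0 x <= 1.
Proof.
have [/cutoff_le0->//|x0] := leP x 0.
by rewrite cutoff0E// -[leRHS]expR0 ler_expR oppr_le0 invr_ge0 ltW.
Qed.

Lemma cutoff1_ge0 x : 0 <= cutoff 1 x.
Proof.
have [/cutoff_le0->//|x0] := leP x 0.
by rewrite cutoff1E// mulr_ge0// ?cutoff0_ge0// invr_ge0 exprn_ge0// ltW.
Qed.

Lemma cutoff1_gt0 x : 0 < x -> 0 < cutoff 1 x.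
Proof.
by move=> x0; rewrite cutoff1E// mulr_gt0 ?cutoff0_gt0// invr_gt0 exprn_gt0.
Qed.

End flat_functions.

Section continuous_bigops.
Context {R : realType} {T : topologicalType} {I : Type}.
Implicit Types (r : seq I) (P : pred I) (F : I -> T -> R).

Lemma continuous_sumr r P F : (forall i, continuous (F i)) ->
  continuous (fun x => \sum_(i <- r | P i) F i x).
Proof.
move=> cF; apply: continuous_big => [|i _]; last exact: cF.
exact: add_continuous.
Qed.

Lemma continuous_prodr r P F : (forall i, continuous (F i)) ->
  continuous (fun x => \prod_(i <- r | P i) F i x).
Proof.
move=> cF; apply: continuous_big => [|i _]; last exact: cF.
by move=> z; apply: cvgM; [exact: cvg_fst|exact: cvg_snd].
Qed.

End continuous_bigops.

(** * Closure properties of the classes [Ck] *)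

Section Ck_closure.
Context {R : realType} {V : normedModType R}.
Implicit Types (phi psi : V -> R).

Lemma CkW k phi : Ck k.+1 phi -> Ck k phi.
Proof.
elim: k phi => [|k IH] phi [cphi dphi]; split => // v.
by have [? /IH] := dphi v.
Qed.

Lemma Ck_cst k (c : R) : Ck k (fun _ : V => c).
Proof.
elim: k c => [|k IH] c; split => //; try exact: cst_continuous.
move=> v; split=> [x|]; first exact: derivable_cst.
rewrite (_ : 'D_v _ = fun=> 0); first exact: IH.
by apply/funext => x; rewrite derive_cst.
Qed.

Lemma CkD k phi psi : Ck k phi -> Ck k psi -> Ck k (phi \+ psi).
Proof.
elim: k phi psi => [|k IH] phi psi [cf df] [cg dg]; split => //.
- by move=> x; apply: cvgD; [exact: cf|exact: cg].
- by move=> x; apply: cvgD; [exact: cf|exact: cg].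
move=> v; have [dfv Cf] := df v; have [dgv Cg] := dg v; split.
  by move=> x; exact: derivableD.
rewrite (_ : 'D_v _ = 'D_v phi \+ 'D_v psi); first exact: IH.
by apply/funext => x; rewrite deriveD.
Qed.

Lemma CkM k phi psi : Ck k phi -> Ck k psi -> Ck k (phi \* psi).
Proof.
elim: k phi psi => [|k IH] phi psi /[dup] Cphi [cf df] /[dup] Cpsi [cg dg]; split => //.
- by move=> x; apply: cvgM; [exact: cf|exact: cg].
- by move=> x; apply: cvgM; [exact: cf|exact: cg].
move=> v; have [dfv Cf] := df v; have [dgv Cg] := dg v; split.
  by move=> x; exact: derivableM.
rewrite (_ : 'D_v _ = (phi \* 'D_v psi) \+ (psi \* 'D_v phi)).
  by apply: CkD; apply: IH => //; exact: CkW.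
by apply/funext => x; rewrite deriveM.
Qed.

(** Only the restriction of [l] to the line [t *: v + x] enters, and it is affine there, so the
    chain rule in one variable suffices. *)
Lemma is_derive_comp_affine (h : R -> R) (dh : R) (l : V -> R) (x v : V) (c : R) :
  (forall t, l (t *: v + x) = t * c + l x) ->
  is_derive (l x) 1 h dh -> is_derive x v (h \o l) (c * dh).
Proof.
move=> lE dhx.
have lD : is_derive (0 : R) 1 (fun t : R => t * c + l x) c.
  have := is_deriveD (is_deriveM (is_derive_id (0 : R) (1 : R)) (is_derive_cst c (0 :
    R) (1 : R))) (is_derive_cst (l x) (0 : R) (1 : R)).
  move=> H; apply: is_derive_eq.
  by rewrite /= scaler0 add0r addr0 /GRing.scale /= mulr1.
have dh0 : is_derive ((fun t : R => t * c + l x) 0) 1 h dh by rewrite mul0r add0r.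
have [D E] := @is_derive1_comp _ h (fun t : R => t * c + l x) 0 _ _ dh0 lD.
have EQ : (fun t : R => t^-1 *: (((h \o l) \o shift x) (t *: v) - (h \o l) x)) =
    (fun t : R => t^-1 *: (((h \o (fun t : R => t * c + l x)) \o shift 0) (t *: 1) -
      (h \o (fun t : R => t * c + l x)) 0)).
  apply/funext => t /=; rewrite lE addr0 mul0r add0r.
  by rewrite [t%:A]mulr1.
apply: DeriveDef; first by rewrite /derivable EQ.
by rewrite /derive EQ mulrC -E.
Qed.

(** Each directional derivative multiplies by the constant [L v] and raises the index of [h];
    carrying a whole sequence of successive derivatives closes the induction. *)
Lemma Ck_comp_affine k (h : nat -> R -> R) (l L : V -> R) n :
  (forall n (x : R), is_derive x 1 (h n) (h n.+1 x)) ->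
  continuous l -> (forall t v x, l (t *: v + x) = t * L v + l x) ->
  Ck k (h n \o l).
Proof.
move=> hD cl lE.
have C0 m : continuous (h m \o l).
  move=> x; apply: continuous_comp; first exact: cl.
  apply/differentiable_continuous/derivable1_diffP.
  by have [] := hD m (l x).
elim: k n => [|k IH] n; split => // v; split=> [x|].
  by have [] := is_derive_comp_affine (fun t => lE t v x) (hD n (l x)).
rewrite (_ : 'D_v _ = (fun=> L v) \* (h n.+1 \o l)).
  by apply: CkM => //; exact: Ck_cst.
by apply/funext => x; have [_ ->] := is_derive_comp_affine (fun t => lE t v x) (hD n
  (l x)).
Qed.

Lemma Ck_prod k (I : Type) (r : seq I) (F : I -> V -> R) :
  (forall i, Ck k (F i)) -> Ck k (fun x => \prod_(i <- r) F i x).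
Proof.
move=> CF; elim: r => [|i r IH].
  rewrite (_ : (fun _ => _) = fun=> 1); first exact: Ck_cst.
  by apply/funext => x; rewrite big_nil.
rewrite (_ : (fun _ => _) = F i \* (fun x => \prod_(i <- r) F i x)).
  exact: CkM.
by apply/funext => x; rewrite big_cons.
Qed.

Lemma is_derive_prod (I : finType) (F dF : I -> V -> R) (x v : V) :
  (forall i, is_derive x v (F i) (dF i x)) ->
  is_derive x v (fun x => \prod_i F i x)
    (\sum_i dF i x * \prod_(j | j != i) F j x).
Proof.
move=> FD.
(* Uniqueness is needed because the filter [j != i] must delete exactly one factor. *)
suff H (r : seq I) : uniq r -> is_derive x v (fun x => \prod_(i <- r) F i x)
    (\sum_(i <- r) dF i x * \prod_(j <- r | j != i) F j x).
  exact/H/index_enum_uniq.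
elim: r => [|i r IH] /=.
  move=> _; rewrite big_nil (_ : (fun _ => _) = cst 1).
    exact: is_derive_cst.
  by apply/funext => y; rewrite big_nil.
move=> /andP[ir ur].
rewrite (_ : (fun _ => _) = F i * (fun x => \prod_(i <- r) F i x)); last first.
  by apply/funext => y; rewrite big_cons.
apply: (@is_derive_eq _ _ _ _ _ _ _ _ (is_deriveM (FD i) (IH ur))).
rewrite big_cons addrC; congr +%R.
  rewrite big_cons eqxx /= mulrC; congr (_ * _).
  rewrite big_seq [RHS]big_seq_cond; apply: eq_bigl => j.
  by case: (boolP (j \in r)) => //= jr; apply/esym; apply: contraNneq ir => <-.
rewrite /GRing.scale/= big_distrr/= big_seq [RHS]big_seq; apply: eq_bigr => j jr.
rewrite big_cons ifT; last by apply: contraNneq ir => ->.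
by rewrite mulrCA.
Qed.

End Ck_closure.

(** * Lebesgue measure on space-time *)

Section spacetime_measure.
Context {R : realType}.

Definition box {n} (c : 'rV[R]_n) (r : R) : set 'rV[R]_n :=
  [set x | forall i, `|x ord0 i - c ord0 i| < r].

Lemma interval_ball (c r : R) : [set t | `|t - c| < r] = `]c - r, c + r[%classic.
Proof. by apply/seteqP; split => t /=; rewrite in_itv/= ltr_distl. Qed.

Lemma measurable_interval_ball (c r : R) :
  measurable ([set t | `|t - c| < r] : set (measurableTypeR R)).
Proof. by rewrite interval_ball; exact: measurable_itv. Qed.

Lemma measurable_box n (c : 'rV[R]_n) r : measurable (box c r).
Proof.
rewrite (_ : box c r = \bigcap_(i in [set: 'I_n])
    (rV_coord i @^-1` [set t | `|t - c ord0 i| < r])).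
  apply: fin_bigcap_measurable => // i _.
  rewrite -[X in measurable X]setTI.
  by apply: measurable_rV_coord => //; exact: measurable_interval_ball.
by apply/seteqP; split => [x xc i _|x xc i]; [exact: xc|exact: (xc i I)].
Qed.

Lemma lebesgue_interval_ball (c r : R) : 0 < r ->
  lebesgue_measure ([set t | `|t - c| < r] : set (measurableTypeR R)) = (r *+ 2)%:E.
Proof.
move=> r0; rewrite interval_ball lebesgue_measure_itv/= ifT.
  by rewrite EFinN -EFinD; congr (_%:E); ring.
by rewrite lte_fin; lra.
Qed.

Lemma lebesgue_box n (c : 'rV[R]_n) r : 0 < r ->
  lebesgue_rV R n (box c r) = ((r *+ 2) ^+ n)%:E.
Proof.
move=> r0; elim: n c => [|n IH] c /=.
  rewrite diracE mem_set//; by case.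
pose c' : 'rV[R]_n := \row_i c ord0 (lift ord0 i).
rewrite /rV_cons_measure /pushforward.
rewrite (_ : _ @^-1` _ = [set t | `|t - c ord0 ord0| < r] `*` box c' r).
  rewrite product_measure1E; [|exact: measurable_interval_ball|exact: measurable_box].
  rewrite IH exprS EFinM; congr (_ * _)%E; exact: lebesgue_interval_ball.
apply/seteqP; split=> [[t x] /= H|[t x] /= [H1 H2] i].
  split=> [|i].
    by have := H ord0; rewrite rV_cons0.
  by have := H (lift ord0 i); rewrite rV_consS mxE.
case: (unliftP ord0 i) => [j ->|->]; rewrite ?rV_cons0 ?rV_consS//.
by have := H2 j; rewrite mxE.
Qed.

Context {d : nat}.
Notation E := (R * 'rV[R]_d)%type.
Notation mE := (measurableTypeR R * 'rV[R]_d)%type.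

Definition cylinder (c : E) (r : R) : set mE :=
  [set t | `|t - c.1| < r] `*` box c.2 r.

Lemma measurable_cylinder c r : measurable (cylinder c r).
Proof.
by apply: measurableX; [exact: measurable_interval_ball|exact: measurable_box].
Qed.

Lemma lebesgue_cylinder c r : 0 < r ->
  lebesgue_spacetime R d (cylinder c r) = ((r *+ 2) ^+ d.+1)%:E.
Proof.
move=> r0; rewrite [LHS]product_measure1E.
- rewrite exprS EFinM; congr (_ * _)%E; first exact: lebesgue_interval_ball.
  exact: lebesgue_box.
- exact: measurable_interval_ball.
- exact: measurable_box.
Qed.

Lemma cylinder_ball (c : E) (r : R) : 0 < r -> cylinder c r = (ball c r : set E).
Proof.
move=> r0; apply/seteqP; split => -[t x] [/= H1 H2]; split => /=.
- by rewrite -ball_normE /ball_/= distrC.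
- split=> // i j; rewrite !ord1 -ball_normE /ball_/= distrC; exact: H2.
- by move: H1; rewrite -ball_normE /ball_/= distrC.
- move=> i; have := H2.2 ord0 i; by rewrite -ball_normE /ball_/= distrC.
Qed.

(** The sigma-algebra here is the product one, so an open set is exhausted by the countably many
    cylinders with rational centre and radius [1 / (n + 1)] that it contains. *)
Lemma open_measurable_spacetime (A : set E) : open A -> measurable (A : set mE).
Proof.
move=> oA.
pose c (q : (rat * 'rV[rat]_d) * nat) : E := (ratr q.1.1, map_mx ratr q.1.2).
pose B q : set mE := if `[< cylinder (c q) (q.2.+1%:R^-1) `<=` A >]
  then cylinder (c q) (q.2.+1%:R^-1) else set0.
rewrite (_ : A = \bigcup_q B q); last first.
  apply/seteqP; split => [z Az|z [q _]]; last first.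
    by rewrite /B; case: ifPn => // /asboolP; exact.
  have /nbhs_ballP[e /= e0 zA] : nbhs z A by exact: open_nbhs_nbhs.
  (* Radius below [e / 2]: a cylinder whose centre is within its radius of [z] stays in the ball of
     radius [e]. *)
  have [n _ n2e] := near_infty_natSinv_lt (PosNum (divr_gt0 e0 (ltr0Sn R 1))).
  have n2 : n.+1%:R^-1 < e / 2 := n2e n (leqnn _).
  have n0 : (0 : R) < n.+1%:R^-1 by rewrite invr_gt0.
  have appr (x : R) : {q : rat | `|x - ratr q| < n.+1%:R^-1}.
    apply: cid; have /(_ (ball x (n.+1%:R^-1))) := @dense_rat R.
    case.
    - by exists x; exact: ballxx.
    - exact: ball_open.
    - move=> y [+ [q _ qy]]; rewrite -qy -ball_normE /ball_/= => ?.
      by exists q.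
  pose q := ((sval (appr z.1), \row_i sval (appr (z.2 ord0 i))), n).
  exists q => //; rewrite /B ifT.
    split => /=; first exact: (svalP (appr z.1)).
    by move=> i; rewrite !mxE; exact: (svalP (appr (z.2 ord0 i))).
  apply/asboolP => y [/= y1 y2]; apply: zA; rewrite -cylinder_ball//.
  have T (a b m : R) : `|a - b| < n.+1%:R^-1 -> `|m - b| < n.+1%:R^-1 -> `|a - m| < e.
    rewrite (_ : a - m = (a - b) - (m - b)); last by ring.
    move=> h1 h2; apply: (le_lt_trans (ler_normB _ _)).
    apply: (lt_trans (ltrD h1 h2)); move: n2; move: (n.+1%:R^-1) => ?; lra.
  split => /=; first exact: (T _ _ _ y1 (svalP (appr z.1))).
  move=> i; apply: (T _ _ _ (y2 i)).
  by rewrite !mxE; exact: (svalP (appr (z.2 ord0 i))).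
apply: countable_bigcupT_measurable; first exact: countableP.
move=> q; rewrite /B; case: ifPn => // _; exact: measurable_cylinder.
Qed.

Lemma continuous_measurable_spacetime (psi : E -> R) :
  continuous psi -> measurable_fun setT (psi : mE -> R).
Proof.
move=> cpsi; apply: (measurability _ (measurable_realfun.RGenOpens.measurableE R)).
move=> _ [_ [a [b ->] <-]]; rewrite setTI.
apply: open_measurable_spacetime; apply: open_comp => //.
Qed.

Lemma integrable_compact_support (psi : E -> R) (K : set E) :
  continuous psi -> compact K -> (forall z, ~ K z -> psi z = 0) ->
  (lebesgue_spacetime R d).-integrable setT (EFin \o psi).
Proof.
move=> cpsi cK psi0.
have mpsi := continuous_measurable_spacetime cpsi.
have /compact_bounded[N [_ HN]] : compact (psi @` K).
  by apply: continuous_compact => //; exact: continuous_subspaceT.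
have bpsi z : `|psi z| <= `|N| + 1.
  have [Kz|nK] := pselect (K z).
    by apply: (HN (`|N| + 1)); [rewrite (le_lt_trans (ler_norm N))// ltrDl|exists z].
  by rewrite psi0// normr0 addr_ge0.
have [M [_ HM]] := compact_bounded cK.
pose r := `|M| + 2; have r0 : 0 < r by rewrite ltr_wpDl.
have KC : K `<=` cylinder 0 r.
  move=> z Kz; rewrite cylinder_ball// -ball_normE /ball_/= sub0r normrN.
  apply: (@le_lt_trans _ _ (`|M| + 1)).
    by apply: (HM (`|M| + 1)) => //; rewrite (le_lt_trans (ler_norm M))// ltrDl.
  by rewrite /r ltrD2l ltr1n.
apply: (@le_integrable _ _ _ _ _ _ _ (EFin \o (fun z => (`|N| + 1) * \1_(cylinder 0
  r) z))) => //.
- exact/measurable_EFinP.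
- move=> z _ /=; rewrite lee_fin.
  have [Kz|nK] := pselect (K z).
    rewrite indicE mem_set ?mulr1; last exact: KC.
    by rewrite (le_trans (bpsi z))// ler_norm.
  by rewrite psi0// normr0.
- rewrite (_ : EFin \o _ = (fun z => (`|N| + 1)%:E * (EFin \o \1_(cylinder 0%R r))
  z)%E)//.
  apply: integrableZl => //; apply/integrableP; split.
    by apply/measurable_EFinP; apply: measurable_indic; exact: measurable_cylinder.
  rewrite (eq_integral (fun z => (\1_(cylinder 0%R r) z)%:E)); last first.
    by move=> t _; rewrite gee0_abs// lee_fin.
  rewrite integral_indic//; last exact: measurable_cylinder.
  by rewrite setIT lebesgue_cylinder// ltry.
Qed.

End spacetime_measure.

Lemma Rintegral_continuous_gt0 (R : realType) (d : nat) (psi : R * 'rV[R]_d -> R) c :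
  continuous psi -> (forall z, 0 <= psi z) ->
  (lebesgue_spacetime R d).-integrable setT (EFin \o psi) ->
  0 < psi c -> 0 < \int[lebesgue_spacetime R d]_z psi z.
Proof.
move=> cpsi psi0 ipsi pc.
have pc2 : 0 < psi c / 2 by rewrite divr_gt0.
have /nbhs_ballP[r /= r0 Hr] : nbhs c [set z | psi c / 2 < psi z].
  have : psi c / 2 < psi c by lra.
  by move=> h; apply: (cvgr_gt (psi c) (cpsi c)).
have ccyl : cylinder c r `<=` [set z | psi c / 2 < psi z].
  by rewrite cylinder_ball.
have ind : (lebesgue_spacetime R d).-integrable setT
    (EFin \o (fun z => psi c / 2 * \1_(cylinder c r) z)).
  apply: le_integrable ipsi => //.
    apply/measurable_EFinP; apply: measurable_funM => //.
    by apply: measurable_indic; exact: measurable_cylinder.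
  move=> z _ /=; rewrite lee_fin indicE.
  have [zc|zc] := boolP (z \in cylinder c r).
    rewrite mulr1 !ger0_norm ?(ltW pc2)//.
    by apply/ltW/ccyl; rewrite inE in zc.
  by rewrite mulr0 normr0.
apply: (@lt_le_trans _ _ (psi c / 2 * (r *+ 2) ^+ d.+1)).
  by rewrite mulr_gt0// exprn_gt0// mulrn_wgt0.
apply: (@le_trans _ _ (\int[lebesgue_spacetime R d]_z (psi c / 2 * \1_(cylinder c r)
  z))).
  rewrite RintegralZl//.
    rewrite /Rintegral integral_indic//; last exact: measurable_cylinder.
    by rewrite setIT lebesgue_cylinder.
  move: ind => /(@integrableZl _ _ _ _ _ measurableT (psi c / 2)^-1).
  apply: eq_integrable => // z _ /=.
  by rewrite -EFinM mulKf// gt_eqF.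
apply: le_Rintegral => //.
move=> z _; rewrite indicE; have [zc|zc] := boolP (z \in cylinder c r).
  by rewrite mulr1; apply/ltW/ccyl; rewrite inE in zc.
by rewrite mulr0.
Qed.

(** * Calculus on the unit interval *)

Section unit_interval_calculus.
Context {R : realType}.
Implicit Types (k N : R -> R).

Lemma is_derive_continuous N (x dN : R) : is_derive x 1 N dN -> {for x, continuous N}.
Proof. by move=> [D _]; apply/differentiable_continuous/derivable1_diffP. Qed.

Lemma MVT_cc N k (a b : R) : a <= b ->
  (forall x : R, a <= x <= b -> is_derive x 1 N (k x)) ->
  exists2 c, a <= c <= b & N b - N a = k c * (b - a).
Proof.
move=> ab ND.
have [] := @MVT_segment _ N k a b ab.
- by move=> x; rewrite in_itv/= => /andP[ax xb]; apply: ND; rewrite !ltW.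
- apply: continuous_in_subspaceT => x; rewrite inE/= in_itv/= => xab.
  exact: is_derive_continuous (ND _ xab).
- by move=> c; rewrite in_itv/= => cab E; exists c.
Qed.

Lemma is_derive_ge0_le N k (a b : R) :
  (forall x : R, a <= x <= b -> is_derive x 1 N (k x)) ->
  (forall x : R, a <= x <= b -> 0 <= k x) ->
  forall x y, a <= x -> x <= y -> y <= b -> N x <= N y.
Proof.
move=> ND k0 x y ax xy yb.
have [|c /andP[xc cy] E] := @MVT_cc N k x y xy.
  by move=> z /andP[xz zy]; apply: ND; rewrite (le_trans ax)//= (le_trans zy).
rewrite -subr_ge0 E mulr_ge0// ?subr_ge0//.
by rewrite k0// (le_trans ax xc) (le_trans cy yb).
Qed.

Lemma antiderivative k : continuous k ->
  exists2 P : R -> R, P 0 = 0 & forall x : R, 0 <= x <= 1 -> is_derive x 1 P (k x).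
Proof.
move=> ck.
(* Integrating from -1, on an interval that reaches up to 2, makes every point of [[0, 1]] interior,
   so the derivative is two-sided at 0 and 1 as well. *)
pose F x := \int[@lebesgue_measure R]_(t in [set` Interval (BLeft (-1)) (BRight x)])
  k t.
exists (F \- cst (F 0)); first by rewrite /= subrr.
move=> x /andP[x0 x1].
have int : (@lebesgue_measure R).-integrable [set` Interval (BLeft (-1)) (BRight (2 :
  R))] (EFin \o k).
  apply: continuous_compact_integrable; first exact: segment_compact.
  exact: continuous_subspaceT.
have x2 : x < 2 by lra.
have [] := @continuous_FTC1 _ k (BLeft (-1)) x 2 x2 int.
- by rewrite /= lte_fin; lra.
- exact: ck.
move=> DF EF.
have FD : is_derive x 1 F (k x) by apply: DeriveDef => //; rewrite -derive1E.
have := is_deriveB FD (is_derive_cst (F 0) x 1).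
by rewrite subr0.
Qed.

(** Every point of the interval, endpoints included, is a limit of other points of it; this makes
    the limits defining [derive1_in] unique. *)
Lemma unit_interval_dnbhs_proper (a : R) : 0 <= a <= 1 ->
  ProperFilter (within unit_interval a^').
Proof.
move=> /andP[a0 a1]; apply: Build_ProperFilter_ex => P [e /= e0 HP].
have [m [m0 me m2]] : exists m : R, [/\ 0 < m, m < e & m <= 1 / 2].
  by exists (Num.min (e / 2) (1 / 2)); have [] := leP (e / 2) (1 / 2); split; lra.
have [a12|a12] := leP a (1 / 2).
  exists (a + m); apply: HP.
  - by rewrite /ball_/= opprD addNKr normrN gtr0_norm.
  - by rewrite -subr_eq0 addrC addKr gt_eqF.
  - by rewrite /unit_interval/=; lra.
exists (a - m); apply: HP.
- by rewrite /ball_/= opprB addrC subrK gtr0_norm.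
- by rewrite -subr_eq0 addrC addKr oppr_eq0 gt_eqF.
- by rewrite /unit_interval/=; lra.
Qed.

Lemma cvg_derive1_in (V : normedModType R) (P : R -> V) (a : R) dP : 0 <= a <= 1 ->
  (fun x => (x - a)^-1 *: (P x - P a)) @ within unit_interval a^' --> dP ->
  derivable_in unit_interval P a /\ derive1_in unit_interval P a = dP.
Proof.
move=> a01 H; split; first exact: cvgP H.
have FF := unit_interval_dnbhs_proper a01.
exact: cvg_lim H.
Qed.

Lemma is_derive_in (V : normedModType R) (P : R -> V) (a : R) dP : 0 <= a <= 1 ->
  is_derive a 1 P dP ->
  derivable_in unit_interval P a /\ derive1_in unit_interval P a = dP.
Proof.
move=> a01 [D E]; apply: cvg_derive1_in => //.
have H : (fun h => h^-1 *: ((P \o shift a) (h *: 1) - P a)) @ 0^' --> dP.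
  by rewrite -E; exact: D.
apply/cvgrPdist_lt => e e0; move/cvgrPdist_lt : H => /(_ e e0)[r /= r0 Hr].
exists r => // x /= xr xa _.
have := Hr (x - a); rewrite /= [_%:A]mulr1 subrK; apply.
  by rewrite /= sub0r opprB.
by rewrite subr_eq0.
Qed.

Lemma tangent_le N k (x z : R) :
  (forall x : R, 0 <= x <= 1 -> is_derive x 1 N (k x)) ->
  (forall x y, x <= y -> k x <= k y) ->
  0 <= x <= 1 -> 0 <= z <= 1 -> N z + k z * (x - z) <= N x.
Proof.
move=> ND kinc /andP[x0 x1] /andP[z0 z1].
have [xz|zx] := leP x z.
  have [|c /andP[xc cz] E] := @MVT_cc N k x z xz.
    by move=> y /andP[xy yz]; apply: ND; rewrite (le_trans x0 xy) (le_trans yz z1).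
  have := kinc _ _ cz.
  have -> : N x = N z - k c * (z - x) by rewrite -E; ring.
  by move=> kcz; nra.
have [|c /andP[zc cx] E] := @MVT_cc N k z x (ltW zx).
  by move=> y /andP[zy yx]; apply: ND; rewrite (le_trans z0 zy) (le_trans yx x1).
have := kinc _ _ zc.
have -> : N x = N z + k c * (x - z) by rewrite -E; ring.
by move=> kcz; nra.
Qed.

Lemma nondecreasing_derive_convex N k :
  (forall x : R, 0 <= x <= 1 -> is_derive x 1 N (k x)) ->
  (forall x y, x <= y -> k x <= k y) ->
  @convex_function R R^o unit_interval N.
Proof.
move=> ND kinc t x y; rewrite !inE => x01 y01.
change (N (t%:num * x + (1 - t%:num) * y) <= t%:num * N x + (1 - t%:num) * N y).
have t0 : 0 <= t%:num by [].
have t1 : t%:num <= 1 by [].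
suff H (s a b : R) : 0 <= s -> s <= 1 -> 0 <= a <= 1 -> 0 <= b <= 1 ->
    N (s * a + (1 - s) * b) <= s * N a + (1 - s) * N b by exact: H.
move=> s0 s1 a01 b01; set z := s * a + _.
have z01 : 0 <= z <= 1.
  by move: a01 b01 => /andP[? ?] /andP[? ?]; apply/andP; split; rewrite /z; nra.
have := tangent_le ND kinc a01 z01; have := tangent_le ND kinc b01 z01.
move=> Hb Ha.
(* As [z] is the barycentre of [a] and [b], the slopes cancel in the average of the two tangent
   inequalities. *)
rewrite (_ : N z = s * (N z + k z * (a - z)) + (1 - s) * (N z + k z * (b - z))).
  by apply: lerD; apply: ler_wpM2l => //; rewrite subr_ge0.
by rewrite /z; ring.
Qed.

End unit_interval_calculus.

(** * Entropy balances *)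

Section kinetic_balance.
Context {R : realType} {d : nat}.
Notation E := (R * 'rV[R]_d)%type.
Notation mu := (lebesgue_spacetime R d).
Implicit Types (f F Q : R -> 'rV[R]_d) (g u phi : E -> R) (k N : R -> R).

(** Later estimates compare integrands pointwise, so the essentially bounded source is truncated at
    its bound, which changes it on a null set only. *)
Lemma Lfun_oo_bounded g : g \in Lfun mu +oo%E ->
  exists G g', [/\ 0 < G, measurable_fun setT g, measurable_fun setT g',
    forall z, `|g' z| <= G & {ae mu, forall z, g z = g' z}].
Proof.
rewrite inE/= => /andP[]; rewrite !inE/= => mg; rewrite /finite_norm unlock /Lnorm.
(* At exponent infinity the norm is an essential supremum only if the whole space has positive
   measure. *)
have mu0 : (0 < mu setT)%E.
  apply: (@lt_le_trans _ _ (mu (cylinder 0 1))).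
    by rewrite lebesgue_cylinder// lte_fin exprn_gt0.
  by apply: le_measure => //; rewrite inE; [exact: measurable_cylinder|].
rewrite mu0 => /ess_supr_bounded[M HM].
pose G := `|M| + 1; have G0 : 0 < G by rewrite ltr_wpDl.
exists G, (fun z => Num.max (- G) (Num.min G (g z))); split => //.
- apply: measurable_maxr => //; exact: measurable_minr.
- move=> z; rewrite ler_norml ge_max le_max lexx /= ge_min lexx andbT.
  by rewrite ?andbT; lra.
- apply: filterS HM => z /= gM.
  have gG : `|g z| <= G.
    by rewrite (le_trans gM)// (le_trans (ler_norm M))// lerDl.
  move: gG; rewrite ler_norml => /andP[g1 g2].
  by rewrite min_r// max_r.
Qed.

Lemma test_function_supportP phi : test_function phi ->
  exists2 K : set E, compact K & forall z, ~ K z ->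
    phi z = 0 /\ forall v, 'D_v phi z = 0.
Proof.
move=> [_ cK]; exists (closure [set z | phi z != 0]) => // z nKz.
have oK : open (~` closure [set z | phi z != 0]).
  by apply: closed_openC; exact: closed_closure.
have z0 x : ~ closure [set z | phi z != 0] x -> phi x = 0.
  move=> nx; apply: contrapT => /eqP px; apply: nx; exact: subset_closure.
split; first exact: z0.
move=> v; rewrite -(derive_cst (0 : R) z v); apply: near_eq_derive.
have : nbhs z (~` closure [set z | phi z != 0]) by exact: open_nbhs_nbhs.
by apply: filterS => x /z0.
Qed.

(** A nondecreasing continuous [k] is the derivative of a convex entropy [N], whose flux [Q] is an
    antiderivative of [k F]. Replacing [g] by its bounded representative [g'] is invisible under the
    integral. *)
Lemma nondecreasing_entropy_balance f F g g' u k (G : R) :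
  isentropic f g u -> continuous u -> (forall z, 0 <= u z <= 1) ->
  continuous F -> (forall v, 0 <= v <= 1 -> derive1_in unit_interval f v = F v) ->
  measurable_fun setT g -> measurable_fun setT g' -> (forall z, `|g' z| <= G) ->
  {ae mu, forall z, g z = g' z} ->
  continuous k -> (forall x y, x <= y -> k x <= k y) ->
  exists N Q, [/\ N 0 = 0 /\ forall i, Q 0 ord0 i = 0,
    forall x : R, 0 <= x <= 1 -> is_derive x 1 N (k x),
    forall (x : R) i, 0 <= x <= 1 -> is_derive x 1 (fun v => Q v ord0 i) (k x * F x
      ord0 i) &
    forall phi, test_function phi ->
      let I z := N (u z) * dt phi z + \sum_i Q (u z) ord0 i * dx i phi z +
         k (u z) * phi z * g' z in
      mu.-integrable setT (EFin \o I) /\ \int[mu]_z I z = 0].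
Proof.
move=> isen cu u01 cF fF mg mg' bg' gg' ck kinc.
have [N N0 ND] := antiderivative ck.
have cFi i : continuous (fun v => F v ord0 i).
  by move=> v; apply: (@continuous_comp _ _ _ F (fun M : 'rV[R]_d => M ord0 i));
    [exact: cF|exact: coord_continuous].
have ckF i : continuous (fun v => k v * F v ord0 i).
  by move=> v; apply: cvgM; [exact: ck|exact: cFi].
have /choice[q Hq] : forall i, exists P : R -> R, P 0 = 0 /\
    forall x : R, 0 <= x <= 1 -> is_derive x 1 P (k x * F x ord0 i).
  by move=> i; have [P P0 PD] := antiderivative (ckF i); exists P.
pose Q v : 'rV[R]_d := \row_i q i v.
have QD (x : R) i : 0 <= x <= 1 -> is_derive x 1 (fun v => Q v ord0 i) (k x * F x
  ord0 i).
  move=> x01; rewrite (_ : (fun _ => _) = q i).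
    exact: (Hq i).2.
  by apply/funext => v; rewrite mxE.
exists N, Q; split => //.
  by split => // i; rewrite mxE (Hq i).1.
have QD' (x : R) : 0 <= x <= 1 -> is_derive x 1 Q (k x *: F x).
  move=> x01.
  have D : derivable Q x 1.
    by apply/derivable_mxP => i j; rewrite ord1; have [] := QD x j x01.
  apply: DeriveDef => //; rewrite derive_mx//.
  by apply/rowP => j; rewrite !mxE; have [_ ->] := QD x j x01.
have epair : entropy_pair f N Q.
  split; first exact: nondecreasing_derive_convex ND kinc.
  move=> v v01.
  have [D1 E1] := is_derive_in v01 (ND _ v01 : is_derive v 1 (N : R -> R^o) (k v :
    R^o)).
  have [D2 E2] := is_derive_in v01 (QD' _ v01).
  by split => //; rewrite E1 E2 fF.
move=> phi tphi.
have := isen _ _ epair phi tphi.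
have [K cK HK] := test_function_supportP tphi.
have cphi : continuous phi by have := tphi.1 0%N => -[].
have cdphi v : continuous ('D_v phi).
  by have [_ dphi] := tphi.1 1%N; have [_ [cv _]] := dphi v.
have cNu : continuous (N \o u).
  by move=> z; apply: continuous_comp; [exact: cu|exact: is_derive_continuous (ND _
    (u01 z))].
have cQu i : continuous ((fun v => Q v ord0 i) \o u).
  by move=> z; apply: continuous_comp; [exact: cu|exact: is_derive_continuous (QD _ i
    (u01 z))].
have cku : continuous (k \o u).
  by move=> z; apply: continuous_comp; [exact: cu|exact: ck].
pose A z := N (u z) * dt phi z + \sum_i Q (u z) ord0 i * dx i phi z.
pose B z := k (u z) * phi z.
have iA : mu.-integrable setT (EFin \o A).
  apply: (integrable_compact_support (K := K)) => //.
    move=> z; apply: cvgD; first by apply: cvgM; [exact: cNu|exact: cdphi].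
    apply: continuous_sumr => i {}z; apply: cvgM; [exact: cQu|exact: cdphi].
  move=> z nKz; have [_ H] := HK z nKz.
  by rewrite /A /dt /dx H mulr0 add0r big1// => i _; rewrite H mulr0.
have cB : continuous B by move=> z; apply: cvgM; [exact: cku|exact: cphi].
have iB : mu.-integrable setT (EFin \o B).
  apply: (integrable_compact_support (K := K)) => //.
  by move=> z nKz; have [H _] := HK z nKz; rewrite /B H mulr0.
have iC : mu.-integrable setT (EFin \o (fun z => B z * g' z)).
  rewrite (_ : EFin \o _ = ((EFin \o g') \* (EFin \o B))%E); last first.
    by apply/funext => z /=; rewrite mulrC EFinM.
  apply: integrableMr => //.
  exists G; split; first by rewrite num_real.
  by move=> M GM z _ /=; rewrite (le_trans (bg' z))// ltW.
move=> bal I.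
have IE : EFin \o I = (EFin \o (fun z => A z + B z * g' z)) by [].
split.
  rewrite IE (_ : EFin \o _ = ((EFin \o A) \+ (EFin \o (fun z => B z * g' z)%R))%E)//.
  exact: integrableD.
rewrite /I RintegralD//.
move: bal => /eqP; rewrite eqr_oppLR => /eqP ->.
apply/eqP; rewrite addrC subr_eq0; apply/eqP.
rewrite /Rintegral; congr fine.
apply: ae_eq_integral => //.
- exact: measurable_int iC.
- apply/measurable_EFinP.
  rewrite (_ : (fun _ => _) = (fun z => B z * g z)).
    by apply: measurable_funM => //; exact: continuous_measurable_spacetime.
  apply/funext => z; rewrite /B.
  have [_ ->] := is_derive_in (u01 z) (ND _ (u01 z) : is_derive (u z) 1 (N : R ->
    R^o) (k (u z) : R^o)).
  by ring.
- have FF := @ae_filter_ringOfSetsType _ _ _ mu.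
  apply: filterS gg' => z /= gz _; congr EFin; rewrite /B -gz.
  have [_ ->] := is_derive_in (u01 z) (ND _ (u01 z) : is_derive (u z) 1 (N : R ->
    R^o) (k (u z) : R^o)).
  by ring.
Qed.

End kinetic_balance.

Section kinetic_solution.
Context {R : realType} {d : nat}.
Notation E := (R * 'rV[R]_d)%type.
Notation mu := (lebesgue_spacetime R d).
Implicit Types (f F Q : R -> 'rV[R]_d) (g u phi : E -> R) (k N : R -> R).

(** Convexity forces entropy derivatives to be monotone, while bumps are wanted; a bump is written
    [k1 - k2], and the balances subtract because they are equalities. [F] stands for the derivative
    of the flux, extended to the whole line. *)
Definition kinetic_solution F g u :=
  forall k1 k2, continuous k1 -> continuous k2 ->
    (forall x y, x <= y -> k1 x <= k1 y) -> (forall x y, x <= y -> k2 x <= k2 y) ->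
  exists N Q, [/\ N 0 = 0 /\ forall i, Q 0 ord0 i = 0,
    forall x : R, 0 <= x <= 1 -> is_derive x 1 N (k1 x - k2 x),
    forall (x : R) i, 0 <= x <= 1 ->
      is_derive x 1 (fun v => Q v ord0 i) ((k1 x - k2 x) * F x ord0 i) &
    forall phi, test_function phi ->
      let I z := N (u z) * dt phi z + \sum_i Q (u z) ord0 i * dx i phi z +
         (k1 (u z) - k2 (u z)) * phi z * g z in
      mu.-integrable setT (EFin \o I) /\ \int[mu]_z I z = 0].

Lemma isentropic_kinetic f F g g' u (G : R) :
  isentropic f g u -> continuous u -> (forall z, 0 <= u z <= 1) ->
  continuous F -> (forall v, 0 <= v <= 1 -> derive1_in unit_interval f v = F v) ->
  measurable_fun setT g -> measurable_fun setT g' -> (forall z, `|g' z| <= G) ->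
  {ae mu, forall z, g z = g' z} -> kinetic_solution F g' u.
Proof.
move=> isen cu u01 cF fF mg mg' bg' gg' k1 k2 ck1 ck2 inc1 inc2.
have [N1 [Q1 [[N10 Q10] DN1 DQ1 B1]]] :=
  nondecreasing_entropy_balance isen cu u01 cF fF mg mg' bg' gg' ck1 inc1.
have [N2 [Q2 [[N20 Q20] DN2 DQ2 B2]]] :=
  nondecreasing_entropy_balance isen cu u01 cF fF mg mg' bg' gg' ck2 inc2.
exists (N1 \- N2), (Q1 \- Q2); split.
- by split => [|i] /=; rewrite ?mxE ?N10 ?N20 ?Q10 ?Q20 subrr.
- by move=> x x01; apply: is_deriveB; [exact: DN1|exact: DN2].
- move=> x i x01; rewrite mulrBl.
  rewrite (_ : (fun _ => _) = (fun v => Q1 v ord0 i) - (fun v => Q2 v ord0 i)).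
    by apply: is_deriveB; [exact: DQ1|exact: DQ2].
  by apply/funext => v; rewrite /= !mxE.
move=> phi tphi I.
have [i1 E1] := B1 _ tphi; have [i2 E2] := B2 _ tphi.
set I1 := (fun z : E => _ : R) in i1 E1; set I2 := (fun z : E => _ : R) in i2 E2.
have IE z : I z = I1 z - I2 z.
  rewrite /I /I1 /I2 /=.
  under eq_bigr do rewrite !mxE mulrBl.
  by rewrite sumrB; ring.
have -> : I = (fun z => I1 z - I2 z) by apply/funext.
split; last by rewrite RintegralB// E1 E2 subrr.
rewrite (_ : EFin \o _ = ((EFin \o I1) \- (EFin \o I2))%E)//.
exact: integrableB.
Qed.

End kinetic_solution.

(** * The exponential entropy profile *)

Section profile.
Context {R : realType}.
Implicit Types (a b m v x y : R).

Definition clamp a b x := Num.max a (Num.min b x).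

Lemma continuous_clamp a b : continuous (clamp a b).
Proof.
move=> x; apply: continuous_max; first exact: cvg_cst.
by apply: continuous_min; [exact: cvg_cst|exact: cvg_id].
Qed.

Lemma clamp_le a b x y : x <= y -> clamp a b x <= clamp a b y.
Proof.
move=> xy; rewrite /clamp ge_max !le_max lexx /= le_min !ge_min lexx xy /=.
by rewrite orbT orbT.
Qed.

Lemma clamp_lel a b x : a <= b -> x <= a -> clamp a b x = a.
Proof. by move=> ab xa; rewrite /clamp min_r ?(le_trans xa)// max_l. Qed.

Lemma clamp_ler a b x : a <= b -> b <= x -> clamp a b x = b.
Proof. by move=> ab bx; rewrite /clamp min_l// max_r. Qed.

Lemma clamp_in a b x : a <= x <= b -> clamp a b x = x.
Proof. by move=> /andP[ax xb]; rewrite /clamp min_r// max_r. Qed.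

Lemma clamp_itv a b x : a <= b -> a <= clamp a b x <= b.
Proof.
by move=> ab; rewrite /clamp le_max lexx /= ge_max ab /= ge_min lexx.
Qed.

(* On [v0, v1] the profile k solves k' = m (k + 1), so that an exponentially
   growing weight in time absorbs the source term up to an additive constant. *)
Lemma exponential_profile (v0 v1 w m : R) : 0 <= v0 -> v0 < v1 -> v1 < w -> w <= 1 ->
  0 < m ->
  exists k1 k2 : R -> R,
  [/\ continuous k1 /\ continuous k2,
     (forall x y, x <= y -> k1 x <= k1 y) /\ (forall x y, x <= y -> k2 x <= k2 y),
     (forall v, 0 <= k1 v - k2 v),
     (forall v, v <= v0 \/ w <= v -> k1 v - k2 v = 0) &
     forall N : R -> R, N 0 = 0 ->
       (forall x : R, 0 <= x <= 1 -> is_derive x 1 N (k1 x - k2 x)) ->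
       m * N v1 = expR (m * (v1 - v0)) - 1 - m * (v1 - v0) /\
       forall v, 0 <= v <= 1 -> k1 v - k2 v <= m * N v + m * (v1 - v0)].
Proof.
move=> v00 v01 v1w w1 m0.
(* [k1] climbs from 0 to [A] on [[v0, v1]] along the exponential and [k2] climbs to the same [A] on
   [[v1, w]], so the difference is a bump supported in [[v0, w]]. *)
pose k1 v := expR (m * (clamp v0 v1 v - v0)) - 1.
pose A := expR (m * (v1 - v0)) - 1.
pose k2 v := A * clamp 0 1 ((v - v1) / (w - v1)).
have A0 : 0 <= A.
  by rewrite /A subr_ge0 -[leLHS]expR0 ler_expR mulr_ge0// ?subr_ge0// ltW.
have wv : 0 < w - v1 by lra.
have inc1 x y : x <= y -> k1 x <= k1 y.
  move=> xy; rewrite lerD2r ler_expR ler_wpM2l ?(ltW m0)// lerD2r.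
  exact: clamp_le.
have inc2 x y : x <= y -> k2 x <= k2 y.
  move=> xy; rewrite ler_wpM2l//; apply: clamp_le.
  by rewrite ler_wpM2r ?invr_ge0 ?(ltW wv)// lerD2r.
have k1lo v : v <= v0 -> k1 v = 0.
  by move=> vv; rewrite /k1 (clamp_lel (ltW v01) vv) subrr mulr0 expR0 subrr.
have k1hi v : v1 <= v -> k1 v = A.
  by move=> vv; rewrite /k1 (clamp_ler (ltW v01) vv).
have k2lo v : v <= v1 -> k2 v = 0.
  move=> vv; rewrite /k2 clamp_lel ?mulr0//.
  by rewrite pmulr_lle0 ?invr_gt0// subr_le0.
have k2hi v : w <= v -> k2 v = A.
  move=> vv; rewrite /k2 clamp_ler ?mulr1//.
  by rewrite ler_pdivlMr// mul1r lerD2r.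
have k10 v : 0 <= k1 v.
  have [vv|vv] := leP v v0; first by rewrite k1lo.
  by rewrite -(k1lo v0 (lexx _)); apply: inc1; exact: ltW.
have k2A v : k2 v <= A.
  rewrite -[leRHS]mulr1 ler_wpM2l//.
  by have /andP[] := @clamp_itv 0 1 ((v - v1) / (w - v1)) ler01.
have k20 v : 0 <= k2 v.
  rewrite mulr_ge0//.
  by have /andP[] := @clamp_itv 0 1 ((v - v1) / (w - v1)) ler01.
exists k1, k2; split => //.
- split => x.
    apply: cvgB; last exact: cvg_cst.
    apply: (continuous_comp (f := fun v => m * (clamp v0 v1 v - v0)));
      last exact: continuous_expR.
    apply: cvgM; first exact: cvg_cst.
    by apply: cvgB; [exact: continuous_clamp|exact: cvg_cst].
  apply: cvgM; first exact: cvg_cst.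
  apply: (continuous_comp (f := fun v => (v - v1) / (w - v1)));
    last exact: continuous_clamp.
  apply: cvgM; last exact: cvg_cst.
  by apply: cvgB; [exact: cvg_id|exact: cvg_cst].
- move=> v; have [vv|vv] := leP v v1; first by rewrite k2lo// subr0.
  by rewrite (k1hi _ (ltW vv)) subr_ge0.
- move=> v [vv|vv]; last by rewrite k1hi ?k2hi ?subrr// (le_trans _ vv)// ltW.
  by rewrite k1lo// k2lo ?subrr// (le_trans vv)// ltW.
move=> N N0 ND.
have Nv0 : N v0 = 0.
  have [|c /andP[c0 cv] E] := MVT_cc v00 (N := N) (k := fun v => k1 v - k2 v).
    by move=> x /andP[x0 xv]; apply: ND; rewrite x0 (le_trans xv)//; lra.
  move: E; rewrite N0 subr0 => ->.
  by rewrite k1lo// k2lo ?subrr ?mul0r//; lra.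
have NE v : v0 <= v <= v1 -> m * N v = expR (m * (v - v0)) - 1 - m * (v - v0).
  move=> /andP[vv vv1].
  (* On this interval the bump equals [exp (m (v - v0)) - 1], so [D] has zero derivative and keeps
     its value -1 at [v0]. *)
  pose D := (fun v => m * N v) - (expR \o (fun v => m * (v - v0))) + (fun v => m * (v
    - v0)).
  have DD (x : R) : v0 <= x <= v -> is_derive x 1 D 0.
    move=> /andP[xv0 xv].
    have x01 : 0 <= x <= 1 by apply/andP; split; lra.
    have d1 := is_deriveM (is_derive_cst m x (1:R)) (ND _ x01).
    have d2 : is_derive x 1 (fun v => m * (v - v0)) m.
      have := is_deriveM (is_derive_cst m x (1:R)) (is_deriveB (is_derive_id x (1:R))
        (is_derive_cst v0 x (1:R))).
      by move=> ?; apply: is_derive_eq; rewrite /= scaler0 addr0 subr0 /GRing.scale/=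
        mulr1.
    have d3 := @is_derive1_comp _ expR (fun v => m * (v - v0)) x _ _ (is_derive_expR
      (m * (x - v0))) d2.
    have := is_deriveD (is_deriveB d1 d3) d2.
    move=> H; apply: (@is_derive_eq _ _ _ _ _ _ _ _ H).
    rewrite /= scaler0 addr0 /GRing.scale/= k2lo ?(le_trans xv)// /k1 clamp_in;
      first by ring.
    by rewrite xv0 (le_trans xv).
  have [c _ E] := MVT_cc vv DD.
  have DE x : D x = m * N x - expR (m * (x - v0)) + m * (x - v0) by [].
  move: E; rewrite mul0r !DE Nv0 subrr !mulr0 expR0 => E.
  lra.
split; first by rewrite NE// (ltW v01) lexx.
move=> v /andP[v_0 v_1].
have [vv0|vv0] := leP v v0.
  rewrite k1lo// k2lo; last by lra.
  rewrite subrr (_ : N v = 0) ?mulr0 ?add0r ?mulr_ge0 ?subr_ge0 ?(ltW m0) ?(ltW v01)//.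
  have [|c /andP[c0 cv] E] := MVT_cc v_0 (N := N) (k := fun v => k1 v - k2 v).
    by move=> x /andP[x0 xv]; apply: ND; rewrite x0 (le_trans xv)//; lra.
  move: E; rewrite N0 subr0 => ->.
  by rewrite k1lo ?k2lo ?subrr ?mul0r//; lra.
have [vv1|vv1] := leP v v1.
  rewrite NE; last by rewrite (ltW vv0) vv1.
  rewrite k2lo// subr0 /k1 clamp_in ?(ltW vv0)//.
  have : m * (v - v0) <= m * (v1 - v0) by rewrite ler_wpM2l ?(ltW m0)// lerD2r.
  lra.
(* Past [v1] the bump stays below [A] and [N] does not decrease, so the bound reached at [v1]
   persists. *)
apply: (@le_trans _ _ A).
  by rewrite (k1hi _ (ltW vv1)) gerBl.
rewrite (_ : A = m * N v1 + m * (v1 - v0)); last first.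
  by rewrite NE ?(ltW v01) ?lexx// /A; ring.
rewrite lerD2r ler_wpM2l ?(ltW m0)//.
apply: (@is_derive_ge0_le _ N (fun x => k1 x - k2 x) v1 v) => //; last exact: ltW.
- by move=> x /andP[xv1 xv]; apply: ND; apply/andP; split; lra.
- move=> x /andP[xv1 xv]; by rewrite k1hi// subr_ge0.
Qed.

End profile.

(** * Test functions supported in a moving cube *)

Section moving_cube.
Context {R : realType} {d : nat}.
Notation E := (R * 'rV[R]_d)%type.
Notation mu := (lebesgue_spacetime R d).
Context (t0 : R) (x0 a : 'rV[R]_d) (sg eps kap M tau : R).
Implicit Types (z V : E) (j : 'I_d * bool).

(** Elapsed time in the direction given by [sg], later a sign: one argument covers propagation to
    the future and to the past. *)
Definition age z := sg * (z.1 - t0).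

Definition deviation z (i : 'I_d) :=
  z.2 ord0 i - x0 ord0 i - (z.1 - t0) * a ord0 i.

Definition bsign (b : bool) : R := if b then 1 else -1.

(** The [2 d] faces of a cube whose centre passes through [x0] at time [t0] with velocity [a] and
    whose half-side is [kap + M * age z]; all of them are positive exactly inside. *)
Definition face j z := kap + M * age z + bsign j.2 * deviation z j.1.

Definition face_lin j V :=
  M * sg * V.1 + bsign j.2 * (V.2 ord0 j.1 - V.1 * a ord0 j.1).

Definition cube z := \prod_j cutoff 0 (face j z).

Definition window z := cutoff 0 (age z + eps) * cutoff 0 (tau + eps - age z).

(** What the opening of the window contributes to its derivative, cut down by the last factor to
    negative ages, where a lower bound on [u] is at hand. *)
Definition window_gain z :=
  cutoff 1 (age z + eps) * cutoff 0 (tau + eps - age z) * cutoff 0 (- age z).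

Definition cube_test (lam : R) z := expR (lam * age z) * (window z * cube z).

Lemma continuous_fst : continuous (fun z : E => z.1).
Proof. by move=> z; exact: cvg_fst. Qed.

Lemma continuous_coord i : continuous (fun z : E => z.2 ord0 i).
Proof.
move=> z; apply: (@continuous_comp _ _ _ snd (fun A : 'rV[R]_d => A ord0 i));
  first exact: cvg_snd.
exact: coord_continuous.
Qed.

Lemma continuous_age : continuous age.
Proof.
move=> z; apply: cvgM; first exact: cvg_cst.
by apply: cvgB; [exact: continuous_fst|exact: cvg_cst].
Qed.

Lemma continuous_deviation i : continuous (deviation ^~ i).
Proof.
move=> z; apply: cvgB.
  by apply: cvgB; [exact: continuous_coord|exact: cvg_cst].
apply: cvgM; last exact: cvg_cst.
by apply: cvgB; [exact: continuous_fst|exact: cvg_cst].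
Qed.

Lemma continuous_face j : continuous (face j).
Proof.
move=> z; apply: cvgD.
  apply: cvgD; first exact: cvg_cst.
  by apply: cvgM; [exact: cvg_cst|exact: continuous_age].
by apply: cvgM; [exact: cvg_cst|exact: continuous_deviation].
Qed.

Lemma age_affine t V z : age (t *: V + z) = t * (sg * V.1) + age z.
Proof. by rewrite /age /=; rewrite /GRing.scale /=; ring. Qed.

Lemma face_affine j t V z : face j (t *: V + z) = t * face_lin j V + face j z.
Proof.
rewrite /face age_affine /deviation /face_lin !mxE /=.
by rewrite /GRing.scale /=; ring.
Qed.

Lemma Ck_age_comp k (h : nat -> R -> R) n :
  (forall n (x : R), is_derive x 1 (h n) (h n.+1 x)) -> forall b c,
  Ck k (fun z => h n (b * age z + c)).
Proof.
move=> hD b c.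
apply: (@Ck_comp_affine _ _ k h (fun z => b * age z + c) (fun V => b * (sg * V.1)) n
  hD).
  move=> z; apply: cvgD; last exact: cvg_cst.
  by apply: cvgM; [exact: cvg_cst|exact: continuous_age].
by move=> t V z; rewrite age_affine; ring.
Qed.

Lemma is_derive_age_comp (h : R -> R) (dh b c : R) z V :
  is_derive (b * age z + c) 1 h dh ->
  is_derive z V (fun z => h (b * age z + c)) (b * (sg * V.1) * dh).
Proof.
move=> hD.
apply: (@is_derive_comp_affine _ _ h dh (fun z => b * age z + c)) => //.
by move=> t; rewrite age_affine; ring.
Qed.

Lemma windowE z : window z = cutoff 0 (1 * age z + eps) * cutoff 0 (-1 * age z + (tau
  + eps)).
Proof. by rewrite /window mul1r mulN1r [in X in _ * cutoff 0 X]addrC. Qed.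

Lemma Ck_cube_test k lam : Ck k (cube_test lam).
Proof.
rewrite (_ : cube_test lam = (fun z => expR (lam * age z + 0)) \*
  (((fun z => cutoff 0 (1 * age z + eps)) \*
    (fun z => cutoff 0 (-1 * age z + (tau + eps)))) \* cube)); last first.
  by apply/funext => z; rewrite /cube_test windowE -(addr0 (lam * age z)).
apply: CkM; first exact: (@Ck_age_comp k (fun=> expR) 0%N (fun=> @is_derive_expR R)).
apply: CkM.
  by apply: CkM; apply: Ck_age_comp => n x; exact: is_derive_cutoff.
apply: Ck_prod => j.
apply: (@Ck_comp_affine _ _ k cutoff (face j) (face_lin j) 0%N).
- by move=> n x; exact: is_derive_cutoff.
- exact: continuous_face.
- by move=> t V z; rewrite face_affine.
Qed.

Definition cube_slope z j :=
  cutoff 1 (face j z) * \prod_(j' | j' != j) cutoff 0 (face j' z).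

Lemma cube_slope_ge0 z j : 0 <= cube_slope z j.
Proof.
by rewrite mulr_ge0 ?cutoff1_ge0// prodr_ge0// => i _; exact: cutoff0_ge0.
Qed.

(** Derivative of [exp (lam * age) * window] with respect to the age, without the exponential
    factor. *)
Definition window_slope lam z :=
  lam * window z + cutoff 1 (age z + eps) * cutoff 0 (tau + eps - age z)
  - cutoff 0 (age z + eps) * cutoff 1 (tau + eps - age z).

Lemma derive_cube_test lam z V : 'D_V (cube_test lam) z =
  expR (lam * age z) * (sg * V.1 * window_slope lam z * cube z +
    window z * \sum_j face_lin j V * cube_slope z j).
Proof.
have d1 := @is_derive_age_comp expR _ lam 0 z V (is_derive_expR _).
have d2 := @is_derive_age_comp (cutoff 0) _ 1 eps z V (is_derive_cutoff _ _).
have d3 := @is_derive_age_comp (cutoff 0) _ (-1) (tau + eps) z V (is_derive_cutoff _ _).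
have d4 : is_derive z V cube (\sum_j (face_lin j V * cutoff 1 (face j z)) *
    \prod_(j' | j' != j) cutoff 0 (face j' z)).
  apply: (@is_derive_prod _ _ _ (fun j => cutoff 0 \o face j)
    (fun j z => face_lin j V * cutoff 1 (face j z))) => j.
  apply: is_derive_comp_affine; last exact: is_derive_cutoff.
  by move=> t; exact: face_affine.
have dd := is_deriveM d1 (is_deriveM (is_deriveM d2 d3) d4).
rewrite (_ : cube_test lam = (fun z => expR (lam * age z + 0)) *
  (((fun z => cutoff 0 (1 * age z + eps)) *
    (fun z => cutoff 0 (-1 * age z + (tau + eps)))) * cube)); last first.
  by apply/funext => z'; rewrite /cube_test windowE -{1}[lam * age z']addr0.
have [_ ->] := dd.
under eq_bigr do rewrite -mulrA -/(cube_slope z _).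
set S := \sum_j _.
have E1 : lam * age z + 0 = lam * age z by rewrite addr0.
have E2 : 1 * age z + eps = age z + eps by rewrite mul1r.
have E3 : -1 * age z + (tau + eps) = tau + eps - age z by ring.
rewrite /window_slope /window E1 E2 E3.
set p := cutoff 0 (age z + eps); set q := cutoff 0 (tau + eps - age z).
set q' := cutoff 1 _; set p' := cutoff 1 _.
change (expR (lam * age z) *
  (cutoff 0 (1 * age z + eps) * cutoff 0 (-1 * age z + (tau + eps)) * S +
   cube z * (p * (-1 * (sg * V.1) * q') + q * (1 * (sg * V.1) * p'))) +
  cutoff 0 (1 * age z + eps) * cutoff 0 (-1 * age z + (tau + eps)) * cube z *
  (lam * (sg * V.1) * expR (lam * age z)) =
  expR (lam * age z) *
  (sg * V.1 * (lam * (p * q) + p' * q - p * q') * cube z + p * q * S)).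
rewrite E2 E3 -/p -/q; ring.
Qed.

Lemma face_linE j (n : R) (q : 'rV[R]_d) : face_lin j (n, q) =
  n * face_lin j (1, 0) + \sum_i q ord0 i * face_lin j (0, delta_mx ord0 i).
Proof.
rewrite (bigD1 j.1)//= big1 => [|i ij]; last first.
  by rewrite /face_lin /= !mxE eqxx eq_sym (negbTE ij) /=; ring.
by rewrite /face_lin /= !mxE !eqxx /=; ring.
Qed.

(** The formula for the derivative is linear in the direction, so an entropy and its flux are tested
    through one derivative, along [(n, q)]. *)
Lemma cube_test_flux lam z (n : R) (q : 'rV[R]_d) :
  n * dt (cube_test lam) z + \sum_i q ord0 i * dx i (cube_test lam) z =
  'D_(n, q) (cube_test lam) z.
Proof.
under eq_bigr do rewrite /dx derive_cube_test /= mulr0 !mul0r add0r.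
rewrite /dt !derive_cube_test.
set S := fun V => \sum_j face_lin j V * cube_slope z j.
have SE : S (n, q) = n * S (1, 0) + \sum_i q ord0 i * S (0, delta_mx ord0 i).
  rewrite /S; under [X in _ + X]eq_bigr do rewrite big_distrr/=.
  rewrite exchange_big /= big_distrr/= -big_split/=; apply: eq_bigr => j _.
  rewrite face_linE mulrDl mulrA big_distrl/=; congr (_ + _).
  by apply: eq_bigr => i _; rewrite mulrA.
rewrite -/(S (1, 0)) -/(S (n, q)) SE /=.
rewrite [X in _ + X = _](_ : _ = expR (lam * age z) * window z *
  \sum_i q ord0 i * S (0, delta_mx ord0 i)).
  rewrite -/(S (1, 0)).
  by move: (S (1, 0)) (\sum_i _ * S _) => ? ?; ring.
by rewrite big_distrr/=; apply: eq_bigr => i _; rewrite -/(S (0, delta_mx ord0 i));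
  ring.
Qed.

Section support.
Context (sg2 : sg * sg = 1).
Context (M0 : 0 <= M).
Context (eps0 : 0 < eps).
Context (tau0 : 0 < tau).

Lemma face_gt0P z : (forall j, 0 < face j z) <->
  (forall i, `|deviation z i| < kap + M * age z).
Proof.
split=> [H i|H [i b]].
  have := H (i, true); have := H (i, false).
  rewrite /face /bsign /= ltr_norml => h1 h2; apply/andP; split; lra.
have := H i; rewrite ltr_norml => /andP[h1 h2].
by rewrite /face /bsign /=; case: b; lra.
Qed.

Lemma cube_ge0 z : 0 <= cube z.
Proof. by apply: prodr_ge0 => j _; exact: cutoff0_ge0. Qed.

Lemma cube_gt0P z : 0 < cube z <-> (forall i, `|deviation z i| < kap + M * age z).
Proof.
rewrite -face_gt0P; split=> [H j|H].
  rewrite ltNge; apply/negP => /cutoff_le0 fj; move: H.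
  by rewrite /cube (bigD1 j)//= fj mul0r ltxx.
by apply: prodr_gt0 => j _; apply: cutoff0_gt0.
Qed.

Lemma normr_age z : `|z.1 - t0| = `|age z|.
Proof.
have sg1 : `|sg| = 1.
  have : `|sg| ^+ 2 = 1 by rewrite expr2 -normrM sg2 normr1.
  by move/eqP; rewrite sqrp_eq1// => /eqP.
by rewrite /age normrM sg1 mul1r.
Qed.

Lemma moving_cube_compact : exists2 K : set E, compact K &
  forall z, - eps < age z < tau + eps ->
    (forall i, `|deviation z i| < kap + M * age z) -> K z.
Proof.
pose T := tau + eps.
pose B i := kap + M * T + `|x0 ord0 i| + T * `|a ord0 i|.
exists (`[t0 - T, t0 + T]%classic `*` [set x : 'rV[R]_d | forall i, `[- B i,
  B i]%classic (x ord0 i)]).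
  apply: compact_setX; first exact: segment_compact.
  by apply: (@rV_compact R d (fun i => `[- B i, B i]%classic)) => i;
    exact: segment_compact.
move=> z /andP[z1 z2] H.
have za : `|z.1 - t0| <= T.
  rewrite normr_age ler_norml /T; have := tau0; have := eps0 => e0 t00.
  by apply/andP; split; lra.
split => /=.
  by rewrite in_itv/=; move: za; rewrite ler_distl.
move=> i; rewrite in_itv/= -ler_norml.
have -> : z.2 ord0 i = deviation z i + (x0 ord0 i + (z.1 - t0) * a ord0 i).
  by rewrite /deviation; ring.
apply: (le_trans (ler_normD _ _)); rewrite /B -addrA; apply: lerD.
  apply: (le_trans (ltW (H i))); rewrite lerD2l ler_wpM2l//.
  exact: ltW.
apply: (le_trans (ler_normD _ _)); rewrite lerD2l normrM ler_wpM2r//.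
Qed.

Lemma continuous_cube : continuous cube.
Proof.
apply: continuous_prodr => j z.
apply: (@continuous_comp _ _ _ (face j) (cutoff 0)).
  exact: continuous_face.
exact: continuous_cutoff.
Qed.

Lemma continuous_cutoff_age n (b c : R) : continuous (fun z : E => cutoff n (b * age
  z + c)).
Proof.
move=> z; apply: (@continuous_comp _ _ _ (fun z => b * age z + c) (cutoff n)).
  apply: cvgD; last exact: cvg_cst.
  by apply: cvgM; [exact: cvg_cst|exact: continuous_age].
exact: continuous_cutoff.
Qed.

Lemma integrable_cube_window (w : E -> R) : continuous w ->
  (forall z, age z <= - eps \/ tau + eps <= age z -> w z = 0) ->
  mu.-integrable setT (EFin \o (fun z => w z * cube z)).
Proof.
move=> cw w0; have [K cK HK] := moving_cube_compact.
apply: (integrable_compact_support (K := K)) => //.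
  by move=> z; apply: cvgM; [exact: cw|exact: continuous_cube].
move=> z nK; have [z1|z1] := leP (age z) (- eps).
  by rewrite w0 ?mul0r//; left.
have [z2|z2] := leP (tau + eps) (age z).
  by rewrite w0 ?mul0r//; right.
suff -> : cube z = 0 by rewrite mulr0.
apply/eqP; rewrite eq_le cube_ge0 andbT leNgt; apply/negP => /cube_gt0P.
by move/(HK z _); rewrite z1 z2 => /(_ isT).
Qed.

Lemma continuous_window : continuous (window : E -> R).
Proof.
rewrite (_ : (window : E -> R) = (fun z : E => cutoff 0 (1 * age z + eps) *
    cutoff 0 (-1 * age z + (tau + eps)))).
  by move=> z; apply: cvgM; exact: continuous_cutoff_age.
by apply/funext => z; rewrite /window; congr (cutoff 0 _ * cutoff 0 _); ring.
Qed.

Lemma window_eq0 z : age z <= - eps \/ tau + eps <= age z -> window z = 0.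
Proof.
move=> [h|h]; rewrite /window.
  by rewrite [X in X * _]cutoff_le0 ?mul0r//; lra.
by rewrite [X in _ * X]cutoff_le0 ?mulr0//; lra.
Qed.

Lemma continuous_window_gain : continuous (window_gain : E -> R).
Proof.
rewrite (_ : (window_gain : E -> R) = (fun z : E => cutoff 1 (1 * age z + eps)
    * cutoff 0 (-1 * age z + (tau + eps)) * cutoff 0 (-1 * age z + 0))).
  by move=> z; apply: cvgM; [apply: cvgM|]; exact: continuous_cutoff_age.
apply/funext => z; rewrite /window_gain.
by congr (cutoff 1 _ * cutoff 0 _ * cutoff 0 _); ring.
Qed.

Lemma window_gain_eq0 z :
  age z <= - eps \/ tau + eps <= age z -> window_gain z = 0.
Proof.
move=> [h|h]; rewrite /window_gain.
  by rewrite [X in X * _ * _]cutoff_le0 ?mul0r//; lra.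
by rewrite [X in _ * X * _]cutoff_le0 ?mulr0 ?mul0r//; lra.
Qed.

Lemma window_gain_ge0 z : 0 <= window_gain z.
Proof. by rewrite !mulr_ge0 ?cutoff1_ge0 ?cutoff0_ge0. Qed.

Lemma test_function_cube_test lam : test_function (cube_test lam).
Proof.
split; first by move=> k; exact: Ck_cube_test.
have [K cK HK] := moving_cube_compact.
have clK : closed K by apply: compact_closed => //; exact: norm_hausdorff.
apply: (subclosed_compact _ cK); first exact: closed_closure.
rewrite [X in _ `<=` X]((closure_id K).1 clK); apply: closure_subset => z /=.
rewrite /cube_test mulf_eq0 negb_or mulf_eq0 negb_or => /andP[_ /andP[wz cz]].
apply: HK.
  apply/andP; split; rewrite ltNge; apply: contraNN wz => h.
    by rewrite /window cutoff_le0 ?mul0r//; lra.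
  by rewrite /window [X in _ * X]cutoff_le0 ?mulr0//; lra.
by apply/cube_gt0P; rewrite lt_neqAle eq_sym cz cube_ge0.
Qed.

End support.

End moving_cube.

(** * Propagation of superlevel sets *)

Section propagation.
Context {R : realType} {d : nat}.
Notation E := (R * 'rV[R]_d)%type.
Notation mu := (lebesgue_spacetime R d).

(** Before age [tau] the closing factor has argument at least [eps], so its derivative costs at most
    [eps ^- 2] times the window; raising the rate of the exponential by that amount pays for it. *)
Lemma window_slope_ge (t0 sg eps tau lam : R) (z : E) : 0 < eps -> age t0 sg z < tau ->
  lam * window t0 sg eps tau z +
    cutoff 1 (age t0 sg z + eps) * cutoff 0 (tau + eps - age t0 sg z) <=
  window_slope t0 sg eps tau (lam + eps ^- 2) z.
Proof.
move=> eps0 zt; rewrite /window_slope /window.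
set p := cutoff 0 (_ + eps); set p' := cutoff 1 (_ + eps).
set q := cutoff 0 _; set q' := cutoff 1 _.
have epz : eps <= tau + eps - age t0 sg z by lra.
have q'q : q' <= eps ^- 2 * q.
  rewrite /q' cutoff1E ?(lt_le_trans eps0)// ler_wpM2r ?cutoff0_ge0//.
  by rewrite lef_pV2 ?posrE ?exprn_gt0 ?(lt_le_trans eps0)// lerXn2r ?nnegrE ?(ltW
    eps0)// (le_trans (ltW eps0)).
have p0 : 0 <= p by exact: cutoff0_ge0.
have := ler_wpM2l p0 q'q; lra.
Qed.

(** The quantity is an antiderivative of [k * (M + b * (F - c))]. It expresses that a face receding
    at speed [M] outruns the flux relative to the velocity [c], so that faces contribute with a
    favourable sign. *)
Lemma flux_deviation_ge0 (k N q F : R -> R) (c M b : R) :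
  N 0 = 0 -> q 0 = 0 ->
  (forall x : R, 0 <= x <= 1 -> is_derive x 1 N (k x)) ->
  (forall x : R, 0 <= x <= 1 -> is_derive x 1 q (k x * F x)) ->
  (forall x, 0 <= x <= 1 -> 0 <= k x * (M + b * (F x - c))) ->
  forall v, 0 <= v <= 1 -> 0 <= M * N v + b * (q v - N v * c).
Proof.
move=> N0 q0 DN Dq kF v /andP[v0 v1].
pose D := ((cst M * N) + cst b * (q - N * cst c) : R -> R).
have DE x : D x = M * N x + b * (q x - N x * c) by [].
have D0 : D 0 = 0 by rewrite DE N0 q0; ring.
rewrite -DE -D0.
have DD x : 0 <= x <= 1 -> is_derive (x : R) 1 D (k x * (M + b * (F x - c))).
  move=> x01.
  have d1 := is_deriveM (is_derive_cst M x (1:R)) (DN _ x01).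
  have d2 := is_deriveM (DN _ x01) (is_derive_cst c x (1:R)).
  have d3 := is_deriveM (is_derive_cst b x (1:R)) (is_deriveB (Dq _ x01) d2).
  have d4 := is_deriveD d1 d3.
  apply: (@is_derive_eq _ _ _ _ _ _ _ _ d4).
  by rewrite /GRing.scale /=; ring.
exact: (is_derive_ge0_le DD kF (lexx 0) v0 v1).
Qed.

(** The balance tested with [cube_test] integrates to 0, and its integrand, up to the sign [sg],
    dominates the difference of the two integrands compared here. At the opening [u >= w] makes the
    entropy at least [N v1]; at the closing [u <= v0] makes it vanish; in between the rate [lam]
    absorbs the source. *)
Lemma propagation_inequality (F : R -> 'rV[R]_d) (g u : E -> R)
    (G t0 : R) (x0 : 'rV[R]_d) (w sg eps kap M tau v0 v1 lam : R) :
  kinetic_solution F g u -> 0 < G -> (forall z, `|g z| <= G) ->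
  (forall z, 0 <= u z <= 1) ->
  sg * sg = 1 -> 0 <= M -> 0 < eps -> 0 < tau -> 0 < lam ->
  0 <= v0 -> v0 < v1 -> v1 < w -> w <= 1 ->
  (forall v i, v0 <= v <= w -> `|F v ord0 i - F w ord0 i| <= M) ->
  (forall z, - eps < age t0 sg z <= 0 ->
    (forall i, `|deviation t0 x0 (F w) z i| < kap + M * age t0 sg z) -> w <= u z) ->
  (forall z, tau <= age t0 sg z < tau + eps ->
    (forall i, `|deviation t0 x0 (F w) z i| < kap + M * age t0 sg z) -> u z <= v0) ->
  forall L m : R, L = lam + eps ^- 2 -> m = lam / G ->
  expR (- (L * eps)) * ((expR (m * (v1 - v0)) - 1 - m * (v1 - v0)) / m) *
    \int[mu]_z (window_gain t0 sg eps tau z * cube t0 x0 (F w) sg kap M z) <=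
  lam * (v1 - v0) * expR (L * tau) *
    \int[mu]_z (window t0 sg eps tau z * cube t0 x0 (F w) sg kap M z).
Proof.
move=> kin G0 gG u01 sg2 M0 eps0 tau0 lam0 v00 v01 v1w w1 HM Hw Hv L m LE mE.
have m0 : 0 < m by rewrite mE divr_gt0.
have [k1 [k2 [[ck1 ck2] [inc1 inc2] k0 kout kN]]] :=
  exponential_profile v00 v01 v1w w1 m0.
have [N [Q [[N0 Q0] DN DQ BN]]] := kin k1 k2 ck1 ck2 inc1 inc2.
have [NEv1 kleN] := kN N N0 DN.
have w01 : 0 <= w <= 1 by apply/andP; split; lra.
pose k x := k1 x - k2 x.
have Ninc x y : 0 <= x -> x <= y -> y <= 1 -> N x <= N y.
  by apply: (is_derive_ge0_le (k := k)) => // z z01; exact: k0.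
have Nge0 v : 0 <= v <= 1 -> 0 <= N v.
  by move=> /andP[? ?]; rewrite -N0; apply: Ninc.
have Nlo v : 0 <= v -> v <= v0 -> N v = 0.
  move=> v_0 vv.
  have [|c /andP[c0 cv] Ec] := MVT_cc (k := k) (N := N) v_0.
    by move=> x /andP[x0' xv]; apply: DN; rewrite x0'/=; lra.
  move: Ec; rewrite N0 subr0 => ->.
  by rewrite /k kout ?mul0r//; left; lra.
have Nhi v : w <= v -> v <= 1 -> N v = N w.
  move=> wv v_1.
  have [|c /andP[c0 cv] Ec] := MVT_cc (k := k) (N := N) wv.
    by move=> x /andP[x0' xv]; apply: DN; apply/andP; split; lra.
  move: Ec; rewrite /k kout ?mul0r; last by right.
  by move=> /eqP; rewrite subr_eq0 => /eqP.
have flux v i b : 0 <= v <= 1 -> b = 1 \/ b = -1 ->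
    0 <= M * N v + b * (Q v ord0 i - N v * F w ord0 i).
  move=> v_01 b1.
  apply: (flux_deviation_ge0 N0 (Q0 i) DN (fun x => DQ x i)) v_01 => x x01.
  have [xlo|xlo] := leP x v0; first by rewrite kout ?mul0r//; left.
  have [xhi|xhi] := leP w x; first by rewrite kout ?mul0r//; right.
  apply: mulr_ge0; first exact: k0.
  have := HM x i; rewrite (ltW xlo) (ltW xhi) => /(_ isT).
  by rewrite ler_norml => /andP[h1 h2]; clear -b1 h1 h2; case: b1 => ->; lra.
pose phi := cube_test t0 x0 (F w) sg eps kap M tau L.
have tphi : test_function phi by exact: test_function_cube_test.
have [iI EI] := BN phi tphi.
set I := (fun z : E => _ : R) in iI EI.
pose P z := window_gain t0 sg eps tau z * cube t0 x0 (F w) sg kap M z.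
pose S z := window t0 sg eps tau z * cube t0 x0 (F w) sg kap M z.
have iP : mu.-integrable setT (EFin \o P).
  apply: (integrable_cube_window x0 (F w) kap sg2 M0 eps0 tau0);
    first exact: continuous_window_gain.
  by move=> z; exact: window_gain_eq0.
have iS : mu.-integrable setT (EFin \o S).
  apply: (integrable_cube_window x0 (F w) kap sg2 M0 eps0 tau0);
    first exact: continuous_window.
  by move=> z; exact: window_eq0.
set n1 := (expR _ - 1 - _) / m.
have n1E : n1 = N v1 by rewrite /n1 -NEv1 mulrAC divff ?mul1r// gt_eqF.
set e1 := expR (- _) * n1; set e2 := lam * _ * _.
rewrite -/(P _) -/(S _).
suff low z : e1 * P z - e2 * S z <= sg * I z.
  rewrite -subr_le0 -RintegralZl// -RintegralZl//.
  have iP1 : mu.-integrable setT (EFin \o (fun z => e1 * P z)).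
    exact: (integrableZl measurableT e1 iP).
  have iS1 : mu.-integrable setT (EFin \o (fun z => e2 * S z)).
    exact: (integrableZl measurableT e2 iS).
  rewrite -RintegralB//.
  have -> : (0 : R) = \int[mu]_z (sg * I z) by rewrite RintegralZl// EI mulr0.
  apply: le_Rintegral => //.
    rewrite (_ : EFin \o _ = ((EFin \o (fun z => e1 * P z)%R) \- (EFin \o (fun z =>
      e2 * S z)%R))%E)//.
    exact: integrableB.
    exact: (integrableZl measurableT sg iI).
  by move=> y _; exact: low.
have L0 : 0 < L by rewrite LE ltr_wpDr// invr_ge0 exprn_ge0// ltW.
have n10 : 0 <= n1 by rewrite n1E; apply: Nge0; apply/andP; split; lra.
have e20 : 0 <= e2 by rewrite /e2 !mulr_ge0 ?expR_ge0 ?subr_ge0 ?ltW.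
set s := age t0 sg z; set H := cube t0 x0 (F w) sg kap M z.
set W := window t0 sg eps tau z; set Nu := N (u z); set ku := k (u z).
have uz01 := u01 z; have /andP[uz0 uz1] := uz01.
have Nu0 : 0 <= Nu by exact: Nge0.
have ku0 : 0 <= ku by exact: k0.
have W0 : 0 <= W by rewrite mulr_ge0// cutoff0_ge0.
have H0 : 0 <= H by exact: cube_ge0.
set ex := expR (L * s); have ex0 : 0 < ex by exact: expR_gt0.
set ws := window_slope t0 sg eps tau L z.
have fl j : 0 <= sg * face_lin (F w) sg M j (Nu, Q (u z)).
  rewrite (_ : _ * _ = M * Nu + sg * bsign j.2 * (Q (u z) ord0 j.1 - Nu * F w ord0
    j.1)).
    apply: flux => //.
    have /orP[/eqP->|/eqP->] : (sg == 1) || (sg == -1).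
      by rewrite -sqrf_eq1 expr2 sg2.
    - by rewrite mul1r /bsign; case: j.2; [left|right].
    - by rewrite /bsign; case: j.2; [right|left]; ring.
  by rewrite /face_lin /= mulrDr !mulrA [sg * M]mulrC -[M * sg * sg]mulrA sg2 mulr1.
(* Two nonnegative contributions are dropped: that of the faces, and the one with [G + sg * g z],
   the gap between the source and its worst value. *)
have sgI : ex * H * (Nu * ws - G * ku * W) <= sg * I z.
  rewrite /I cube_test_flux derive_cube_test -/H -/W -/ws -/s -/ex -/ku -/Nu /=.
  rewrite (_ : phi z = ex * (W * H))//.
  set T := \sum_j _.
  have T0 : 0 <= sg * T.
    rewrite /T big_distrr/=; apply: sumr_ge0 => j _.
    by rewrite mulrA mulr_ge0// cube_slope_ge0.
  have gz : 0 <= G + sg * g z.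
    have /orP[/eqP->|/eqP->] : (sg == 1) || (sg == -1).
      by rewrite -sqrf_eq1 expr2 sg2.
    - by have := gG z; rewrite ler_norml => /andP[? ?]; lra.
    - by have := gG z; rewrite ler_norml => /andP[? ?]; lra.
  have -> : sg * (ex * (sg * Nu * ws * H + W * T) + ku * (ex * (W * H)) * g z) =
      ex * H * (Nu * ws - G * ku * W) + (ex * W * (sg * T) + ku * ex * W * H * (G +
        sg * g z))
      + (sg * sg - 1) * (ex * (Nu * ws * H)) by ring.
  rewrite sg2 subrr mul0r addr0 lerDl; have ex0' := ltW ex0; apply: addr_ge0.
    by apply: mulr_ge0 => //; exact: mulr_ge0.
  by apply: mulr_ge0 => //; do 3 apply: mulr_ge0 => //.
apply: (le_trans _ sgI).
rewrite /P /S -/W -/H.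
have [->|Hn0] := eqVneq H 0; first by rewrite !(mulr0, mul0r) subrr.
have /cube_gt0P dev : 0 < H by rewrite lt_neqAle eq_sym Hn0.
set Wg := window_gain t0 sg eps tau z.
suff key : e1 * Wg - e2 * W <= ex * (Nu * ws - G * ku * W).
  rewrite (_ : _ - _ = H * (e1 * Wg - e2 * W)); last by ring.
  by rewrite [leRHS](_ : _ = H * (ex * (Nu * ws - G * ku * W))) ?ler_wpM2l//; ring.
have [sa|sa] := leP s (- eps).
  have p0 n : cutoff n (s + eps) = 0 by apply: cutoff_le0; lra.
  by rewrite /Wg /W /ws /window_gain /window_slope /window -/s !p0; lra.
have [sb|sb] := leP (tau + eps) s.
  have q0 n : cutoff n (tau + eps - s) = 0 by apply: cutoff_le0; lra.
  by rewrite /Wg /W /ws /window_gain /window_slope /window -/s !q0; lra.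
(* While the window closes, entropy and bump vanish, so the slope of the window, negative there
   without control, is multiplied by 0. *)
have [sc|sc] := leP tau s.
  have uv : u z <= v0 by apply: Hv => //; rewrite sc sb.
  have -> : Nu = 0 by exact: Nlo.
  have -> : ku = 0 by apply: kout; left.
  have -> : Wg = 0.
    by rewrite /Wg /window_gain [X in _ * X]cutoff_le0 ?mulr0// oppr_le0 (le_trans _
      sc)// ltW.
  have := mulr_ge0 e20 W0; lra.
have wsge := window_slope_ge lam eps0 sc; rewrite -LE -/W -/ws -/s in wsge.
set p' := cutoff 1 (s + eps) in wsge; set q := cutoff 0 (tau + eps - s) in wsge.
have pq0 : 0 <= p' * q by rewrite mulr_ge0// ?cutoff1_ge0// cutoff0_ge0.
(* Here [m = lam / G] enters: the source is at most [lam] times the entropy, which the weight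
   provides, plus a constant. *)
have Gk : G * ku <= lam * Nu + lam * (v1 - v0).
  have GmE : lam = G * m by rewrite mE mulrC divfK// gt_eqF.
  rewrite (_ : lam * Nu + _ = G * (m * Nu + m * (v1 - v0))); last by rewrite GmE; ring.
  by rewrite ler_wpM2l ?(ltW G0)//; exact: kleN.
apply: (@le_trans _ _ (ex * (Nu * (p' * q) - lam * (v1 - v0) * W))); last first.
  rewrite ler_wpM2l ?(ltW ex0)//.
  have h1 := ler_wpM2l Nu0 wsge; have h2 := ler_wpM2r W0 Gk.
  by nra.
rewrite mulrBr; apply: lerB; last first.
  rewrite /e2 mulrCA -!mulrA; apply: ler_wpM2l; first exact: ltW.
  apply: ler_wpM2l; first by rewrite subr_ge0 ltW.
  by rewrite ler_wpM2r// ler_expR ler_wpM2l// ltW.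
have WgE : Wg = p' * q * cutoff 0 (- s) by [].
have [s0|s0] := leP s 0; last first.
  have c0 : cutoff 0 (- s) = 0 by apply: cutoff_le0; lra.
  by rewrite WgE c0 !mulr0; exact: mulr_ge0 (ltW ex0) (mulr_ge0 Nu0 pq0).
have wu : w <= u z by apply: Hw => //; rewrite sa s0.
have r0 : 0 <= cutoff 0 (- s) by exact: cutoff0_ge0.
rewrite WgE /e1 -mulrA; apply: ler_pM.
- exact: expR_ge0.
- by apply: mulr_ge0 => //; exact: mulr_ge0.
- rewrite ler_expR -mulrN; apply: ler_wpM2l; exact: ltW.
apply: ler_pM => //; first exact: mulr_ge0.
- rewrite n1E /Nu (Nhi _ wu uz1); apply: Ninc; clear -v00 v01 v1w wu uz1; lra.
- by rewrite -[leRHS]mulr1; apply: ler_wpM2l => //; exact: cutoff0_le1.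
Qed.

End propagation.

Section transport.
Context {R : realType} {d : nat}.
Notation E := (R * 'rV[R]_d)%type.
Notation mu := (lebesgue_spacetime R d).

Lemma expR_double_dominates (B : R) : exists2 x : R, 0 < x &
  B * x ^+ 2 * expR (2 * x) < expR (4 * x) - 1 - 4 * x.
Proof.
(* Given [exp (2 x) >= (8 / 27) x^3] below, [x > (27 / 4) B] suffices, whence the 7; the summand 2
   makes [1 + 4 x] at most half of [exp (4 x)]. *)
pose x := 7 * `|B| + 2; exists x; first by rewrite /x ltr_wpDl// mulr_ge0.
have x2 : 2 <= x by rewrite /x lerDr mulr_ge0.
have xB : 7 * B < x.
  rewrite /x; apply: (@le_lt_trans _ _ (7 * `|B|)); last by rewrite ltrDl.
  by rewrite ler_wpM2l// ler_norm.
pose y := expR (2 * x).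
have -> : expR (4 * x) = y * y by rewrite -expRD; congr expR; ring.
rewrite -/y.
have y1 : 1 + 2 * x <= y by exact: expR_ge1Dx.
have y3 : (1 + 2 * x / 3) ^+ 3 <= y.
  have -> : y = expR (2 * x / 3) ^+ 3 by rewrite -expRM_natl; congr expR; field.
  have x3 : 0 <= 1 + 2 * x / 3 by clear -x2; lra.
  by apply: lerXn2r; rewrite ?nnegrE ?expR_ge0//; exact: expR_ge1Dx.
have y8 : 8 / 27 * x ^+ 3 <= y.
  apply: le_trans y3; rewrite -subr_ge0.
  have -> : (1 + 2 * x / 3) ^+ 3 - 8 / 27 * x ^+ 3 = 1 + 2 * x + 4 / 3 * (x * x) by
    field.
  have xx : 0 <= x * x by exact: sqr_ge0.
  clear -x2 xx; lra.
have yy : y * y / 2 <= y * y - 1 - 4 * x.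
  have : (1 + 2 * x) * (1 + 2 * x) <= y * y by apply: ler_pM => //; lra.
  have : 2 * x <= x * x by rewrite ler_wpM2r//; lra.
  move: (y * y) => yy; rewrite (_ : (1 + 2 * x) * (1 + 2 * x) = 1 + 4 * x + 4 * (x *
    x)); last by ring.
  move: (x * x) => xx; clear -x2; lra.
apply: lt_le_trans yy.
have y0 : 0 < y by exact: expR_gt0.
rewrite mulrAC [X in X < _](_ : _ = y * (B * x ^+ 2)); last by ring.
rewrite -mulrA ltr_pM2l// ltr_pdivlMr//.
apply: lt_le_trans y8.
have -> : 8 / 27 * x ^+ 3 = 8 / 27 * x * x ^+ 2 by ring.
rewrite [X in X < _](_ : _ = B * 2 * x ^+ 2); last by ring.
rewrite ltr_pM2r ?exprn_gt0//; clear -x2 xB; lra.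
Qed.

(* With [m := lam / G], [v1 - v0 := 4 G tau] and [eps <= tau] the exponential
   growth of the entropy beats the weight of the test function as [lam] grows. *)
Lemma propagation_limit (G tau eps c J0 J1 : R) : 0 < G -> 0 < tau -> 0 < eps -> eps
  <= tau ->
  0 <= c -> 0 < J0 -> 0 <= J1 ->
  ~ (forall lam, 0 < lam -> expR (- ((lam + c) * eps)) *
      ((expR (lam / G * (4 * G * tau)) - 1 - lam / G * (4 * G * tau)) / (lam / G)) *
        J0 <=
      lam * (4 * G * tau) * expR ((lam + c) * tau) * J1).
Proof.
move=> G0 tau0 eps0 et c0 J00 J10 H.
have [x x0] := expR_double_dominates (4 * expR (2 * c * tau) * J1 / (tau * J0)).
apply/negP; rewrite -leNgt.
(* With [x = lam * tau] the entropy has exponent [4 * x], while the weights contribute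
   [lam * (tau + eps) <= 2 * x]. *)
pose lam := x / tau; have lam0 : 0 < lam by rewrite divr_gt0.
have mE : lam / G * (4 * G * tau) = 4 * x.
  by rewrite /lam; field; rewrite !gt_eqF.
have := H lam lam0; rewrite mE.
set D := expR (4 * x) - 1 - 4 * x => HD.
have e0 : 0 < expR ((lam + c) * eps) by exact: expR_gt0.
have {}HD : D * J0 <= lam * (4 * G * tau) * (lam / G) * expR ((lam + c) * (tau +
  eps)) * J1.
  have lG : 0 < lam / G by rewrite divr_gt0.
  have := ler_wpM2l (ltW (mulr_gt0 e0 lG)) HD.
  rewrite [X in X <= _ -> _](_ : _ = (expR ((lam + c) * eps) * expR (- ((lam + c) *
    eps))) * (D * J0)); last first.
    by field; rewrite !gt_eqF.
  rewrite expRxMexpNx_1 mul1r => h; apply: (le_trans h).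
  rewrite mulrDr expRD le_eqVlt; apply/orP; left; apply/eqP; ring.
have {}HD : D * J0 <= (4 * x ^+ 2 / tau) * (expR (2 * x) * expR (2 * c * tau)) * J1.
  apply: (le_trans HD); rewrite ler_wpM2r//.
  rewrite [X in X * _ <= _](_ : _ = 4 * x ^+ 2 / tau); last first.
    by rewrite /lam; field; rewrite !gt_eqF.
  rewrite ler_wpM2l//.
    by rewrite divr_ge0 ?(ltW tau0)// mulr_ge0// sqr_ge0.
  rewrite -expRD ler_expR (_ : 2 * x + _ = (lam + c) * (2 * tau)); last first.
    by rewrite /lam; field; rewrite gt_eqF.
  by rewrite ler_wpM2l// ?addr_ge0 ?(ltW lam0)//; lra.
rewrite -(ler_pM2r J00); apply: (le_trans HD).
rewrite le_eqVlt; apply/orP; left; apply/eqP; field.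
by rewrite !gt_eqF.
Qed.

(** By contradiction: were [u <= w - 16 G |r|] on the whole target cube, [propagation_inequality]
    would hold for every [lam], against [propagation_limit]. The radius comes from the half-side of
    the cube: growth at rate [M = 8 G Lp |r|] for a time at most [2 |r|] gives [16 G Lp r^2], and
    the initial size and the drift of the centre fit in [r^2]. *)
Lemma kinetic_transport (F : R -> 'rV[R]_d) (g u : E -> R) (G Lp : R) :
  kinetic_solution F g u -> 0 < G -> (forall z, `|g z| <= G) ->
  continuous u -> (forall z, 0 <= u z <= 1) -> 0 <= Lp ->
  (forall v w i, 0 <= v <= 1 -> 0 <= w <= 1 ->
     `|F v ord0 i - F w ord0 i| <= Lp * `|v - w|) ->
  forall (t0 : R) (x0 : 'rV[R]_d) (w r : R), 0 <= w <= 1 -> w < u (t0, x0) ->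
  exists2 y : 'rV[R]_d,
    forall i, `|y ord0 i - x0 ord0 i - r * F w ord0 i| <= (16 * G * Lp + 1) * r ^+ 2 &
    w - 16 * G * `|r| < u (t0 + r, y).
Proof.
move=> kin G0 gG cu u01 Lp0 FL t0 x0 w r w01 wu.
have [->|rn0] := eqVneq r 0.
  exists x0; last by rewrite normr0 mulr0 subr0 addr0.
  by move=> i; rewrite subrr mul0r subr0 normr0 expr0n mulr0.
pose tau := `|r|; have tau0 : 0 < tau by rewrite normr_gt0.
pose c : 'rV[R]_d := \row_i (x0 ord0 i + r * F w ord0 i).
(* For small [w] the level to be beaten is negative and the centre itself will do; otherwise [v0]
   below is nonnegative. *)
have [wK|wK] := ltP w (16 * G * tau).
  exists c; last by rewrite -/tau; have /andP[? _] := u01 (t0 + r, c); lra.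
  move=> i; rewrite mxE -addrA -opprD subrr normr0 mulr_ge0 ?sqr_ge0//.
  by rewrite addr_ge0// !mulr_ge0// ltW.
apply: contrapT => no.
pose rad := (16 * G * Lp + 1) * r ^+ 2.
have uc (y : 'rV[R]_d) : (forall i, `|y ord0 i - c ord0 i| <= rad) -> u (t0 + r,
  y) <= w - 16 * G * tau.
  move=> yc; rewrite leNgt; apply/negP => h; apply: no; exists y => // i.
  by have := yc i; rewrite mxE opprD addrA.
have /andP[w0 w1] := w01.
have Gt : 0 < G * tau by rewrite mulr_gt0.
(* [v1 - v0 = 4 G tau] is the drop that the limit argument asks for; [v0] stays strictly above
   [w - 16 G tau], which leaves room for a neighbourhood of times. *)
pose v0 := w - 8 * G * tau; pose v1 := w - 4 * G * tau.
pose sg := Num.sg r.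
have sg2 : sg * sg = 1 by rewrite /sg -expr2 sqr_sg rn0.
have rE : r = sg * tau by rewrite /sg /tau -numEsg.
pose M := Lp * (8 * G * tau).
have M0 : 0 <= M by rewrite !mulr_ge0// ltW.
have HM v i : v0 <= v <= w -> `|F v ord0 i - F w ord0 i| <= M.
  move=> /andP[vv vw]; apply: (le_trans (FL _ _ _ _ _)) => //.
    by apply/andP; split; rewrite /v0 in vv; lra.
  rewrite ler_wpM2l// ler0_norm ?subr_le0//.
  by rewrite /v0 in vv; lra.
pose A := \sum_i `|F w ord0 i|.
have A0 : 0 <= A by apply: sumr_ge0.
have FA i : `|F w ord0 i| <= A.
  by rewrite /A (bigD1 i)//= lerDl sumr_ge0.
have [rho rho0 Hrho] : exists2 rho, 0 < rho &
    forall z : E, `|z.1 - t0| < rho -> (forall i,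
      `|z.2 ord0 i - x0 ord0 i| < rho) -> w < u z.
  have : nbhs (t0, x0) [set z | w < u z] by exact: (cvgr_gt (u (t0, x0)) (cu (t0, x0))).
  move=> /nbhs_ballP[rho /= rho0 H]; exists rho => // z z1 z2.
  by apply: H; rewrite -cylinder_ball//; split.
(* At time [t0 + r] the strict bound [u < v0] holds on a compact cube, hence on the same cube at all
   nearby times. *)
have [rho2 rho20 Hrho2] : exists2 rho2, 0 < rho2 &
    forall z : E, `|z.1 - (t0 + r)| < rho2 -> (forall i,
      `|z.2 ord0 i - c ord0 i| <= rad) -> u z <= v0.
  pose K := [set y : 'rV[R]_d | forall i, `[c ord0 i - rad,
    c ord0 i + rad]%classic (y ord0 i)].
  have cK : compact K.
    by apply: (@rV_compact R d (fun i => `[c ord0 i - rad,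
      c ord0 i + rad]%classic)) => i; exact: segment_compact.
  have KP y : K y <-> forall i, `|y ord0 i - c ord0 i| <= rad.
    by split=> H i; have := H i; rewrite /= in_itv/= ler_distl.
  move/compact_near_coveringP : cK => cK.
  have := cK R (nbhs (t0 + r)) (fun t y => u (t, y) < v0).
  case.
    move=> y /KP Ky.
    have : nbhs (t0 + r, y) [set z | u z < v0].
      apply: (cvgr_lt (u (t0 + r, y)) (cu (t0 + r, y))).
      by apply: (le_lt_trans (uc _ Ky)); rewrite /v0; lra.
    move=> [[P1 P2] /= [h1 h2] h]; exists (P2, P1) => //= -[y' t'] /= [? ?].
    by apply: (h (t', y')).
  move=> rho2 /= rho20 H; exists rho2 => // -[t y] /= tr /KP Ky.
  by apply/ltW/H => //=; rewrite distrC.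
(* Small against [rho], so that at ages near 0 the cube lies where [u > w], and against [tau ^ 2],
   the slack in the radius. *)
pose kap := Num.min rho (tau ^+ 2) / 2.
have mn0 : 0 < Num.min rho (tau ^+ 2) by rewrite lt_min rho0 exprn_gt0.
have kap0 : 0 < kap by rewrite divr_gt0.
have kap2 : 2 * kap = Num.min rho (tau ^+ 2) by rewrite /kap; field.
have kaprho : 2 * kap <= rho by rewrite kap2 ge_min lexx.
have kaptau : 2 * kap <= tau ^+ 2 by rewrite kap2 ge_min lexx orbT.
pose AM := A + M + 1.
have AM0 : 0 < AM by rewrite ltr_wpDl// addr_ge0.
pose eps := Num.min (Num.min rho rho2) (Num.min tau (kap / AM)).
have eps0 : 0 < eps by rewrite !lt_min rho0 rho20 tau0 divr_gt0.
have /andP[/andP[eps1 eps2] /andP[eps3 eps4]] :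
    ((eps <= rho) && (eps <= rho2)) && ((eps <= tau) && (eps <= kap / AM)).
  by rewrite -!le_min.
have epsAM : eps * AM <= kap by rewrite -ler_pdivlMr.
have epsA : eps * A <= kap.
  by apply: le_trans epsAM; rewrite ler_wpM2l ?(ltW eps0)// /AM -addrA lerDl addr_ge0.
have epsM : eps * M <= kap.
  by apply: le_trans epsAM; rewrite ler_wpM2l ?(ltW eps0)// /AM addrAC lerDr addr_ge0.
have devE (z : E) i : z.2 ord0 i - x0 ord0 i = deviation t0 x0 (F w) z i + (z.1 - t0)
  * F w ord0 i.
  by rewrite /deviation subrK.
have Hw (z : E) : - eps < age t0 sg z <= 0 ->
    (forall i, `|deviation t0 x0 (F w) z i| < kap + M * age t0 sg z) -> w <= u z.
  move=> /andP[z1 z2] dz.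
  have tz : `|z.1 - t0| < eps.
    by rewrite (normr_age _ sg2) ler0_norm//; clear -z1; lra.
  apply/ltW/Hrho; first exact: lt_le_trans eps1.
  move=> i; rewrite devE; apply: (le_lt_trans (ler_normD _ _)).
  have k1 : `|deviation t0 x0 (F w) z i| < kap.
    by apply: (lt_le_trans (dz i)); rewrite gerDl mulr_ge0_le0.
  have k2 : `|(z.1 - t0) * F w ord0 i| <= kap.
    by apply: le_trans epsA; rewrite normrM ler_pM// ltW.
  by clear -k1 k2 kaprho; lra.
have Hv (z : E) : tau <= age t0 sg z < tau + eps ->
    (forall i, `|deviation t0 x0 (F w) z i| < kap + M * age t0 sg z) -> u z <= v0.
  move=> /andP[z1 z2] dz.
  have tz : z.1 - (t0 + r) = sg * (age t0 sg z - tau).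
    by rewrite /age mulrBr mulrA sg2 mul1r -rE opprD addrA.
  have sg1 : `|sg| = 1 by rewrite /sg normr_sg rn0.
  have tz' : `|z.1 - (t0 + r)| < eps.
    by rewrite tz normrM sg1 mul1r ger0_norm; clear -z1 z2; lra.
  apply: Hrho2; first exact: lt_le_trans eps2.
  move=> i; rewrite mxE.
  have -> : z.2 ord0 i - (x0 ord0 i + r * F w ord0 i) =
      deviation t0 x0 (F w) z i + (z.1 - (t0 + r)) * F w ord0 i.
    by rewrite /deviation; ring.
  apply: (le_trans (ler_normD _ _)).
  have k2 : `|(z.1 - (t0 + r)) * F w ord0 i| <= kap.
    by apply: le_trans epsA; rewrite normrM ler_pM// ltW.
  have k1 : `|deviation t0 x0 (F w) z i| <= kap + M * (2 * tau).
    apply: (le_trans (ltW (dz i))); rewrite lerD2l ler_wpM2l//.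
    by clear -z2 eps3; lra.
  have -> : rad = M * (2 * tau) + tau ^+ 2.
    by rewrite /rad /M /tau real_normK ?num_real// -[r ^+ 2]real_normK ?num_real//;
      ring.
  by clear -k1 k2 kaptau; lra.
pose P (z : E) := window_gain t0 sg eps tau z * cube t0 x0 (F w) sg kap M z.
pose J0 := \int[mu]_z P z.
pose J1 := \int[mu]_z (window t0 sg eps tau z * cube t0 x0 (F w) sg kap M z).
have J10 : 0 <= J1.
  apply: Rintegral_ge0 => z _; rewrite mulr_ge0 ?cube_ge0//.
  by rewrite mulr_ge0 ?cutoff0_ge0.
have J00 : 0 < J0.
  (* The point of the axis at age [- eps / 2]: the window has opened, and the half-side is at least
     [kap / 2] since [eps * M <= kap]. *)
  pose z0 : E := (t0 - sg * (eps / 2), \row_i (x0 ord0 i - sg * (eps / 2) * F w ord0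
    i)).
  have a0 : age t0 sg z0 = - (eps / 2).
    by rewrite /age /z0 /= addrAC subrr sub0r mulrN mulrA sg2 mul1r.
  apply: (@Rintegral_continuous_gt0 _ _ P z0).
  - move=> z; apply: cvgM; first exact: continuous_window_gain.
    exact: continuous_cube.
  - by move=> z; rewrite mulr_ge0 ?window_gain_ge0 ?cube_ge0.
  - apply: (integrable_cube_window x0 (F w) kap sg2 M0 eps0 tau0);
    first exact: continuous_window_gain.
    by move=> z; exact: window_gain_eq0.
  - apply: mulr_gt0.
      rewrite /window_gain a0; have e2 : 0 < eps / 2 by rewrite divr_gt0.
      rewrite !mulr_gt0 ?cutoff1_gt0 ?cutoff0_gt0//; clear -e2 tau0; lra.
    apply/cube_gt0P => i; rewrite a0 /deviation /z0 /= mxE.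
    rewrite [X in `|X|](_ : _ = 0); last by ring.
    by rewrite normr0; clear -epsM kap0; lra.
have v00 : 0 <= v0 by rewrite /v0; clear -wK Gt; lra.
have v01 : v0 < v1 by rewrite /v0 /v1; clear -Gt; lra.
have v1w : v1 < w by rewrite /v1; clear -Gt; lra.
have c0 : 0 <= eps ^- 2 by rewrite invr_ge0 exprn_ge0// ltW.
apply: (propagation_limit G0 tau0 eps0 eps3 c0 J00 J10) => lam lam0.
have := propagation_inequality kin G0 gG u01 sg2 M0 eps0 tau0 lam0 v00 v01 v1w w1 HM
  Hw Hv erefl erefl.
by have -> : v1 - v0 = 4 * G * tau by rewrite /v1 /v0; ring.
Qed.

End transport.

(** * Increments of the flux derivative *)

Section clamped_derivatives.
Context {R : realType} {d : nat}.
Implicit Types (f : R -> 'rV[R]_d) (x y : R).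

Lemma clamp01 x : @unit_interval R (clamp 0 1 x).
Proof. exact: clamp_itv. Qed.

Lemma within_continuous_clamp f :
  {within unit_interval, continuous f} -> continuous (f \o clamp 0 1).
Proof.
move=> /subspace_continuousP cf x.
have H := cf _ (clamp01 x).
apply: cvg_trans H => /= A HA.
have H2 := @continuous_clamp R 0 1 x _ HA.
by apply: (@filterS _ (nbhs x) _ _ _ _ H2) => y; apply; exact: clamp01.
Qed.

(** Clamping the argument turns derivatives known on [[0, 1]] into continuous functions on the line;
    corners may appear at 0 and 1, so differentiability is claimed in the interior only. *)
Definition cderiv f j i x := derive1n_in unit_interval j f (clamp 0 1 x) ord0 i.

Lemma cderivE f j i x : 0 <= x <= 1 ->
  cderiv f j i x = derive1n_in unit_interval j f x ord0 i.
Proof. by move=> x01; rewrite /cderiv clamp_in. Qed.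

Context (k : nat) (f : R -> 'rV[R]_d) (fC : Ck_in unit_interval k f).

Lemma continuous_cderiv j i : (j <= k)%N -> continuous (cderiv f j i).
Proof.
move=> jk x; have /within_continuous_clamp cf := fC.2 j jk.
apply: (@continuous_comp _ _ _ (derive1n_in unit_interval j f \o clamp 0 1) (fun A :
  'rV[R]_d => A ord0 i)).
  exact: cf.
exact: coord_continuous.
Qed.

Lemma is_derive_cderiv j i x : (j < k)%N -> 0 < x < 1 ->
  is_derive x 1 (cderiv f j i) (cderiv f j.+1 i x).
Proof.
move=> jk /andP[x0 x1].
have x01 : 0 <= x <= 1 by rewrite !ltW.
have FF := unit_interval_dnbhs_proper x01.
have H : (fun y => (y - x)^-1 *: (derive1n_in unit_interval j f y - derive1n_in
  unit_interval j f x))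
    @ within unit_interval x^' --> derive1n_in unit_interval j.+1 f x.
  exact: (fC.1 j jk x x01).
have Hi : (fun y => (y - x)^-1 * (cderiv f j i y - cderiv f j i x))
    @ within unit_interval x^' --> cderiv f j.+1 i x.
  rewrite !(cderivE _ _ _ x01).
  have Hc := cvg_comp _ _ H (@coord_continuous _ _ _ ord0 i (derive1n_in
    unit_interval j.+1 f x)).
  apply: cvg_trans Hc; apply: near_eq_cvg.
  have W : within unit_interval x^' unit_interval by exact: withinT.
  apply: filterS W => y y01.
  by rewrite /= !mxE (cderivE _ _ _ y01).
have Hd : (fun h => h^-1 *: ((cderiv f j i \o shift x) (h *: 1) - cderiv f j i x)) @
  0^' --> cderiv f j.+1 i x.
  apply/cvgrPdist_lt => e e0; move/cvgrPdist_lt : Hi => /(_ e e0)[r /= r0 Hr].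
  exists (Num.min r (Num.min x (1 - x))) => /=.
    by rewrite !lt_min r0 x0 subr_gt0 x1.
  move=> h /=; rewrite sub0r normrN !lt_min => /andP[hr /andP[hx hx1]] h0.
  have := Hr (h + x); rewrite /= [_%:A]mulr1 addrK; apply.
  - by rewrite opprD addrCA subrr addr0 normrN.
  - by rewrite -subr_eq0 addrK.
  - move: hx hx1; rewrite !ltr_norml => /andP[? ?] /andP[? ?].
    by rewrite /unit_interval/=; lra.
by apply: DeriveDef; [exact: (cvgP _ Hd)|exact: (cvg_lim _ Hd)].
Unshelve. all: by end_near. Qed.

Lemma continuous_bounded01 (h : R -> R) : continuous h ->
  exists2 B, 0 <= B & forall x, 0 <= x <= 1 -> `|h x| <= B.
Proof.
move=> ch.
have /compact_bounded[N [_ HN]] : compact (h @` `[0, 1]%classic).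
  by apply: continuous_compact; [exact: continuous_subspaceT|exact: segment_compact].
exists (`|N| + 1) => [|x x01]; first by rewrite addr_ge0.
by apply: (HN (`|N| + 1)); [rewrite (le_lt_trans (ler_norm N))// ltrDl|exists x =>
  //=; rewrite in_itv].
Qed.

Lemma cderiv_lipschitz : exists2 B, 0 <= B & forall j i x y, (j < k)%N ->
  0 <= x <= 1 -> 0 <= y <= 1 -> `|cderiv f j i x - cderiv f j i y| <= B * `|x - y|.
Proof.
have /choice[B0 HB0] : forall p : 'I_k * 'I_d, exists B, 0 <= B /\
    forall x, 0 <= x <= 1 -> `|cderiv f p.1.+1 p.2 x| <= B.
  move=> p; have [B B0 HB] := continuous_bounded01 (@continuous_cderiv p.1.+1 p.2
    (ltn_ord _)).
  by exists B.
exists (\sum_p B0 p) => [|j i]; first by apply: sumr_ge0 => p _; exact: (HB0 p).1.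
have main x y : (j < k)%N -> 0 <= x <= 1 -> 0 <= y <= 1 -> x <= y ->
    `|cderiv f j i x - cderiv f j i y| <= (\sum_p B0 p) * `|x - y|.
  move=> jk /andP[x0 x1] /andP[y0 y1] xy.
  have [z||c] := @MVT_segment _ (cderiv f j i) (cderiv f j.+1 i) x y xy.
  - rewrite in_itv/= => /andP[xz zy]; apply: is_derive_cderiv => //.
    by rewrite (le_lt_trans x0 xz) (lt_le_trans zy y1).
  - by apply: continuous_subspaceT; apply: continuous_cderiv; exact: ltnW.
  rewrite in_itv/= => /andP[xc cy] E.
  rewrite distrC E normrM [`|x - y|]distrC ler_wpM2r//.
  have := (HB0 (Ordinal jk, i)).2 c => /=.
  rewrite (le_trans x0 xc) (le_trans cy y1) => /(_ isT) h; apply: (le_trans h).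
  by rewrite (bigD1 (Ordinal jk, i))//= lerDl sumr_ge0// => p _; exact: (HB0 p).1.
move=> x y jk x01 y01; have [xy|yx] := leP x y; first exact: main.
by rewrite distrC [`|x - y|]distrC; apply: main => //; exact: ltW.
Qed.

End clamped_derivatives.

(** * Finite differences *)

Section finite_differences.
Context {R : realType}.
Implicit Types (p : R -> R) (h x : R).

Fixpoint fdiff n h p x : R :=
  if n is n'.+1 then fdiff n' h p (x + h) - fdiff n' h p x else p x.

(** The recursion peels off the outer difference; pulling out the inner one leaves a combination of
    first differences of [p], the form wanted for increments. *)
Lemma fdiffSr n h p x :
  fdiff n.+1 h p x = fdiff n h (fun y => p (y + h) - p y) x.
Proof. by elim: n x => [|n IH] x //=; rewrite -IH -IH. Qed.

(** Induction on the order, applied to [p (y + h) - p y] on the shorter interval ending at [b - h],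
    and one more mean value theorem at the end. *)
Lemma fdiff_mean n (p : nat -> R -> R) (a b h x : R) : 0 <= h ->
  (forall j, (j <= n)%N -> continuous (p j)) ->
  (forall j (y : R), (j < n)%N -> a < y < b -> is_derive y 1 (p j) (p j.+1 y)) ->
  a <= x -> x + n%:R * h <= b ->
  exists2 c, x <= c <= x + n%:R * h & fdiff n h (p 0%N) x = h ^+ n * p n c.
Proof.
move=> h0; elim: n p b => [|n IH] p b cp dp ax xb.
  by exists x; rewrite ?mul0r ?addr0 ?lexx// expr0 mul1r.
have nh : n.+1%:R * h = n%:R * h + h by rewrite -natr1 mulrDl mul1r.
rewrite fdiffSr.
have [||||c /andP[xc cx] E] := IH (fun j y => p j (y + h) - p j y) (b - h).
- move=> j jn y; apply: cvgB; last by apply: cp; rewrite leqW.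
  apply: (@continuous_comp _ _ _ (fun y => y + h) (p j)); last by apply: cp;
    rewrite leqW.
  by apply: cvgD; [exact: cvg_id|exact: cvg_cst].
- move=> j y jn /andP[ay yb].
  apply: is_deriveB; last by apply: dp; [rewrite ltnS ltnW|lra].
  have d1 : is_derive (y + h) 1 (p j) (p j.+1 (y + h)).
    by apply: dp; [rewrite ltnS ltnW|lra].
  have d2 := is_deriveD (is_derive_id y (1 : R)) (is_derive_cst h y (1 : R)).
  have := @is_derive1_comp _ (p j) (fun y => y + h) y _ _ d1 d2.
  by rewrite addr0 mulr1.
- exact: ax.
- by move: xb; rewrite nh; lra.
move: E => /= ->.
have [|z||c'] := @MVT_segment _ (p n) (p n.+1) c (c + h).
- by rewrite lerDl.
- by rewrite in_itv/= => /andP[? ?]; apply: dp => //; move: xb; rewrite nh; lra.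
- by apply: continuous_subspaceT; apply: cp.
rewrite in_itv/= => /andP[cc' c'c] ->.
exists c'; first by rewrite nh; apply/andP; split; lra.
by rewrite addrAC subrr add0r exprSr -mulrA [h * _]mulrC.
Qed.

(** The signed binomial coefficients [(-1)^(n-m) binom(n, m)], through Pascal's rule. *)
Fixpoint fcoef n m : R :=
  if n is n'.+1 then (if m is m'.+1 then fcoef n' m' else 0) - fcoef n' m
  else (m == 0%N)%:R.

Lemma fdiff_coef n N h p x : (n < N)%N ->
  fdiff n h p x = \sum_(m < N) fcoef n m * p (x + m%:R * h).
Proof.
elim: n N x => [|n IH] [//|N] x nN.
  rewrite big_ord_recl /= mul0r addr0 mul1r big1 ?addr0// => i _.
  by rewrite mul0r.
rewrite /= (IH N)// (IH N.+1); last exact: ltnW.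
under [RHS]eq_bigr do rewrite mulrBl.
rewrite sumrB; congr (_ - _).
rewrite big_ord_recl /= mul0r add0r; apply: eq_bigr => m _.
by rewrite /bump /= add1n -natr1 mulrDl mul1r addrA [x + h + _]addrAC.
Qed.

End finite_differences.

Section matrix_continuity.
Context {R : realType}.

Lemma continuous_det n (A : R -> 'M[R]_n) :
  (forall i j, continuous (fun x => A x i j)) -> continuous (fun x => \det (A x)).
Proof.
move=> cA; apply: continuous_sumr => s x.
apply: cvgM; first exact: cvg_cst.
by apply: continuous_prodr => i; exact: cA.
Qed.

Lemma continuous_invmx n (A : R -> 'M[R]_n) :
  (forall i j, continuous (fun x => A x i j)) -> (forall x, A x \in unitmx) ->
  forall i j, continuous (fun x => invmx (A x) i j).
Proof.
move=> cA uA i j.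
rewrite (_ : (fun _ => _) = (fun x => (\det (A x))^-1 * cofactor (A x) j i));
  last first.
  by apply/funext => x; rewrite /invmx uA !mxE.
move=> x; apply: cvgM.
  apply: cvgV; last exact: continuous_det.
  by have := uA x; rewrite unitmxE unitfE.
apply: cvgM; first exact: cvg_cst.
apply: continuous_det => a b.
rewrite (_ : (fun _ => _) = (fun x => A x (lift j a) (lift i b))); first exact: cA.
by apply/funext => y; rewrite !mxE.
Qed.

End matrix_continuity.

Section nondegeneracy.
Context {R : realType} {d : nat} (f : R -> 'rV[R]_d).
Context (fC : Ck_in unit_interval d.+2 f).
Context (fspan : forall v : R, 0 <= v <= 1 ->
    <<[seq derive1n_in unit_interval j f v | j <- iota 2 d]>>%VS = fullv).

Definition torsion_mx x : 'M[R]_d := \matrix_(j, i) cderiv f j.+2 i x.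

(** A kernel vector is a linear form vanishing on the spanning derivatives of orders [2] to [d + 1],
    hence zero. *)
Lemma torsion_mx_unit x : torsion_mx x \in unitmx.
Proof.
rewrite unitmxE unitfE -det_tr; apply/det0P => -[v v0 vT].
have /negP := v0; apply; apply/eqP.
pose n : 'cV[R]_d := v^T.
have Mn : torsion_mx x *m n = 0.
  by rewrite -[torsion_mx x]trmxK -trmx_mul vT trmx0.
pose phi : 'Hom('rV[R]_d, 'M[R]_1) := linfun (mulmxr n).
have sub : (<<[seq derive1n_in unit_interval j f (clamp 0 1 x) | j <- iota 2 d]>> <=
  lker phi)%VS.
  apply/span_subvP => _ /mapP[j + ->]; rewrite mem_iota => /andP[j2 jd].
  rewrite memv_ker lfunE /=; apply/eqP.
  have jd' : (j - 2 < d)%N by rewrite ltn_subLR.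
  have := congr1 (row (Ordinal jd')) Mn.
  rewrite row_mul row0 => <-; congr (_ *m _).
  apply/rowP => i; rewrite !mxE /= /cderiv.
  by rewrite -addn2 subnK.
have full (y : 'rV[R]_d) : y *m n = 0.
  have : y \in lker phi.
    by rewrite fspan ?clamp01// in sub; apply: (subvP sub); exact: memvf.
  by rewrite memv_ker lfunE => /eqP.
apply/rowP => i.
have := full (delta_mx ord0 i); rewrite -rowE => /matrixP/(_ ord0 ord0).
by rewrite !mxE.
Qed.

Lemma torsion_mx_inv_bounded : exists2 C, 0 <= C &
  forall x i j, 0 <= x <= 1 -> `|invmx (torsion_mx x) i j| <= C.
Proof.
have cM i j : continuous (fun x => torsion_mx x i j).
  rewrite (_ : (fun _ => _) = cderiv f i.+2 j).
    by apply: (continuous_cderiv fC); rewrite !ltnS ltnW.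
  by apply/funext => x; rewrite mxE.
have /choice[B HB] : forall p : 'I_d * 'I_d, exists B, 0 <= B /\
    forall x, 0 <= x <= 1 -> `|invmx (torsion_mx x) p.1 p.2| <= B.
  move=> p; have [B B0 HB] := continuous_bounded01 (@continuous_invmx _ _ _ cM
    torsion_mx_unit p.1 p.2).
  by exists B.
exists (\sum_p B p) => [|x i j x01]; first by apply: sumr_ge0 => p _; exact: (HB p).1.
apply: (le_trans ((HB (i, j)).2 x x01)).
by rewrite (bigD1 (i, j))//= lerDl sumr_ge0// => p _; exact: (HB p).1.
Qed.

(* Finite differences of order [j] of [f'] with step [h] are [h ^ j f^(j+1)] up
   to [O(h ^ (j+1))], and they are combinations of first differences. *)
Lemma increments_almost_span : exists2 C, 0 <= C &
  forall (x h r : R) (rho : 'rV[R]_d), 0 < h -> h <= 1 -> 0 <= x -> x + d%:R * h <= 1 ->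
    (forall i, `|rho ord0 i| <= r) ->
  exists2 s : nat -> R, forall m, (m < d)%N -> `|s m| <= C * r / h ^+ d &
    forall i, `|\sum_(m < d) s m * (cderiv f 1 i (x + m.+1%:R * h) - cderiv f 1 i (x
      + m%:R * h))
      - rho ord0 i| <= C * h * r.
Proof.
have [C0 C00 HC0] := torsion_mx_inv_bounded.
have [B B0 HB] := cderiv_lipschitz fC.
pose S := \sum_(p : 'I_d * 'I_d) `|fcoef p.1 p.2 : R|.
have S0 : 0 <= S by apply: sumr_ge0.
pose D := d%:R * C0; have D0 : 0 <= D by rewrite mulr_ge0.
pose C1 := D * S; pose C2 := d%:R * (D * (B * d%:R)).
have C10 : 0 <= C1 by rewrite mulr_ge0.
have C20 : 0 <= C2 by rewrite !mulr_ge0.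
exists (C1 + C2); first exact: addr_ge0.
move=> x h r rho h0 h1 x0 xd rhor.
have d0 i : (0 : R) <= i%:R * h by rewrite mulr_ge0// ltW.
have x01 : 0 <= x <= 1 by rewrite x0 (le_trans _ xd)// lerDl.
have [d_eq0|d_gt0] := posnP d.
  have emp (i : 'I_d) : False by case: i => m; rewrite d_eq0.
  by exists (fun=> 0) => [m|i]; [rewrite d_eq0|case: (emp i)].
have r0 : 0 <= r by apply: le_trans (rhor (Ordinal d_gt0)).
(* Coordinates of [rho] in the basis of derivatives at [x]. *)
pose y := rho *m invmx (torsion_mx x).
have yr j : `|y ord0 j| <= D * r.
  rewrite mxE; apply: (le_trans (ler_norm_sum _ _ _)).
  apply: (@le_trans _ _ (\sum_(k < d) r * C0)).
    by apply: ler_sum => k _; rewrite normrM ler_pM// HC0.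
  by rewrite sumr_const card_ord -mulr_natl /D -mulrA [r * C0]mulrC.
have rhoE i : rho ord0 i = \sum_j y ord0 j * cderiv f j.+2 i x.
  have -> : rho = y *m torsion_mx x by rewrite mulmxKV// torsion_mx_unit.
  by rewrite mxE; apply: eq_bigr => j _; rewrite [X in _ * X]mxE.
(* The basis vector of order [j + 2] is approximated by the difference of order [j + 1] of the first
   derivative, over [h ^ (j + 1)]; [s m] collects the coefficient of the [m]-th first difference. *)
pose s (m : nat) := \sum_(j < d) y ord0 j * (h ^+ j.+1)^-1 * fcoef j m.
have hdj (j : 'I_d) : (h ^+ j.+1)^-1 <= (h ^+ d)^-1.
  by rewrite lef_pV2 ?posrE ?exprn_gt0// ler_wiXn2l// ltW.
have hd0 : 0 <= (h ^+ d)^-1 by rewrite invr_ge0 exprn_ge0// ltW.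
exists s => [m md|i].
  apply: (le_trans (ler_norm_sum _ _ _)).
  apply: (@le_trans _ _ (\sum_(j < d) D * r / h ^+ d * `|fcoef j m|)).
    apply: ler_sum => j _; rewrite !normrM ler_wpM2r//.
    apply: ler_pM => //; rewrite ger0_norm; first exact: hdj.
    by rewrite invr_ge0 exprn_ge0// ltW.
  rewrite -mulr_sumr.
  have Sm : \sum_(j < d) `|fcoef j m : R| <= S.
    rewrite /S -(pair_bigA _ (fun j k : 'I_d => `|fcoef j k : R|))/= ler_sum// => j _.
    by rewrite (bigD1 (Ordinal md))//= lerDl sumr_ge0.
  have Drh : 0 <= D * r / h ^+ d by rewrite !mulr_ge0.
  apply: (le_trans (ler_wpM2l Drh Sm)).
  rewrite -[leRHS]mulrA [leLHS](_ : _ = C1 * (r / h ^+ d)); last by rewrite /C1; ring.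
  by rewrite ler_wpM2r ?lerDl// mulr_ge0.
have E : \sum_(m < d) s m * (cderiv f 1 i (x + m.+1%:R * h) - cderiv f 1 i (x + m%:R
  * h)) =
    \sum_j y ord0 j * (h ^+ j.+1)^-1 * fdiff j.+1 h (cderiv f 1 i) x.
  under [RHS]eq_bigr => j _ do rewrite fdiffSr (@fdiff_coef _ j d)// mulr_sumr.
  rewrite exchange_big /=; apply: eq_bigr => m _.
  rewrite /s mulr_suml; apply: eq_bigr => j _.
  by rewrite mulrA; congr (_ * (cderiv f 1 i _ - _)); rewrite -natr1 mulrDl mul1r addrA.
rewrite E rhoE -sumrB; apply: (le_trans (ler_norm_sum _ _ _)).
apply: (@le_trans _ _ (\sum_(j < d) D * r * (B * (d%:R * h)))); last first.
  rewrite sumr_const card_ord -mulr_natl [leLHS](_ : _ = C2 * h * r);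
    last by rewrite /C2; ring.
  by apply: ler_wpM2r => //; apply: ler_wpM2r; [exact: ltW|rewrite lerDr].
apply: ler_sum => j _.
have jd : (j.+1%:R : R) * h <= d%:R * h by rewrite ler_wpM2r ?(ltW h0)// ler_nat.
have [|k kj|k y' kj|||c /andP[xc cx] ->] := @fdiff_mean _ j.+1 (fun k => cderiv f
  k.+1 i) 0 1 h x.
- exact: ltW.
- by apply: (continuous_cderiv fC); rewrite ltnS (leq_trans kj)// leqW.
- by move=> y01; apply: (is_derive_cderiv fC) => //; rewrite ltnS (leq_trans kj)// leqW.
- exact: x0.
- by apply: le_trans xd; rewrite lerD2l.
have c01 : 0 <= c <= 1.
  rewrite (le_trans x0 xc) (le_trans cx)//; apply: le_trans xd; by rewrite lerD2l.
rewrite -mulrA [X in _ * X - _]mulrA mulVf ?mul1r ?gt_eqF ?exprn_gt0//.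
rewrite -mulrBr normrM; apply: ler_pM => //.
(* A Lipschitz bound for the derivative of order [j + 2 <= d + 1]: here the derivative of order
   [d + 2] enters. *)
apply: (le_trans (HB j.+2 i c x _ c01 x01)); first by rewrite !ltnS ltn_ord.
apply: ler_wpM2l => //; rewrite ger0_norm ?subr_ge0// lerBlDl.
by apply: (le_trans cx); rewrite lerD2l.
Qed.

End nondegeneracy.

(** * From propagation to the modulus of continuity *)

Section iteration.
Context {R : realType} {d : nat}.
Implicit Types (F : R -> 'rV[R]_d) (x y z : 'rV[R]_d).

(* Moving forward with velocity [F w'] and back with velocity [F w''] displaces a
   point of [{u > w'}] by [s (F w' - F w'')] up to a quadratic error. *)
Lemma transport_step (u : R * 'rV[R]_d -> R) F (K C L : R) :
  0 < K -> 0 <= L ->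
  (forall v w i, 0 <= v <= 1 -> 0 <= w <= 1 ->
     `|F v ord0 i - F w ord0 i| <= L * `|v - w|) ->
  (forall t x w r, 0 <= w <= 1 -> w < u (t, x) ->
    exists2 y : 'rV[R]_d, forall i, `|y ord0 i - x ord0 i - r * F w ord0 i| <= C * r
      ^+ 2 &
      w - K * `|r| < u (t + r, y)) ->
  forall t x w' w'' s, 0 <= w'' -> w' <= 1 -> 2 * K * `|s| <= w' - w'' ->
    w' < u (t, x) ->
  exists2 z : 'rV[R]_d, w'' < u (t, z) & forall i,
    `|z ord0 i - x ord0 i - s * (F w' ord0 i - F w'' ord0 i)| <=
      (2 * C + L * K) * s ^+ 2.
Proof.
move=> K0 L0 FL T t x w' w'' s w0 w1 sw wu.
have Ks : 0 <= K * `|s| by rewrite mulr_ge0// ltW.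
have w'01 : 0 <= w' <= 1 by apply/andP; split; clear -Ks sw w0 w1; lra.
have [y xy yu] := T t x w' s w'01 wu.
(* The way back costs at most [K * |s|] of level, so it starts that much above [w'']; the hypothesis
   on [w' - w''] leaves as much for the way out. Using [w3] for [w''] changes the displacement by at
   most [L * K * s ^ 2]. *)
pose w3 := w'' + K * `|s|.
have w301 : 0 <= w3 <= 1.
  by rewrite /w3; apply/andP; split; clear -Ks sw w0 w1; lra.
have w3u : w3 < u (t + s, y).
  by apply: le_lt_trans yu; rewrite /w3; clear -Ks sw w0 w1; lra.
have [z yz zu] := T (t + s) y w3 (- s) w301 w3u.
exists z; first by move: zu; rewrite /w3 normrN addrK addrK.
move=> i.
have -> : z ord0 i - x ord0 i - s * (F w' ord0 i - F w'' ord0 i) =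
  (z ord0 i - y ord0 i - - s * F w3 ord0 i) + (y ord0 i - x ord0 i - s * F w' ord0 i)
  - s * (F w3 ord0 i - F w'' ord0 i) by ring.
have e1 := yz i; have e2 := xy i.
have e3 : `|s * (F w3 ord0 i - F w'' ord0 i)| <= L * K * s ^+ 2.
  have w''01 : 0 <= w'' <= 1 by apply/andP; split; clear -Ks sw w0 w1; lra.
  rewrite normrM; apply: (le_trans (ler_wpM2l (normr_ge0 s) (FL _ _ i w301 w''01))).
  rewrite /w3 addrAC subrr add0r normrM normr_id (gtr0_norm K0).
  by rewrite -[s ^+ 2]real_normK ?num_real// le_eqVlt; apply/orP; left; apply/eqP; ring.
apply: (le_trans (ler_normB _ _)); rewrite sqrrN in e1.
have e4 := ler_normD (z ord0 i - y ord0 i - - s * F w3 ord0 i)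
  (y ord0 i - x ord0 i - s * F w' ord0 i).
by clear -e1 e2 e3 e4; lra.
Qed.

Section fixed_time.
Context (phi : 'rV[R]_d -> R) (F : R -> 'rV[R]_d) (K C : R).
Context (K0 : 0 <= K) (C0 : 0 <= C).
Context (step : forall x (w' w'' s : R), 0 <= w'' -> w' <= 1 -> K * `|s| <= w' - w'' ->
    w' < phi x ->
  exists2 z : 'rV[R]_d, w'' < phi z & forall i,
    `|z ord0 i - x ord0 i - s * (F w' ord0 i - F w'' ord0 i)| <= C * s ^+ 2).

(** One descends the grid from [a + n h] to [a], a cell per step; [K * S <= h] says that the height
    of a cell pays for a step of duration up to [S]. The errors add up. *)
Lemma transport_chain n (s : nat -> R) (a h S : R) x : 0 <= a -> 0 <= h ->
  a + n%:R * h <= 1 -> a + n%:R * h < phi x -> 0 <= S -> K * S <= h ->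
  (forall m, (m < n)%N -> `|s m| <= S) ->
  exists2 z, a < phi z & forall i,
    `|z ord0 i - x ord0 i - \sum_(m < n) s m *
        (F (a + m.+1%:R * h) ord0 i - F (a + m%:R * h) ord0 i)| <= n%:R * (C * S ^+ 2).
Proof.
move=> a0 h0; elim: n x => [|n IH] x an xphi S0 KS sS.
  exists x; first by move: xphi; rewrite mul0r addr0.
  by move=> i; rewrite big_ord0 subr0 subrr normr0 mul0r.
have nh : n.+1%:R * h = n%:R * h + h by rewrite -natr1 mulrDl mul1r.
have nh0 : 0 <= n%:R * h by rewrite mulr_ge0.
have [||y yphi xy] := step (s := s n) (w'' := a + n%:R * h) _ an _ xphi.
- exact: addr_ge0.
- apply: (@le_trans _ _ (K * S)); first by rewrite ler_wpM2l// sS.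
  by apply: (le_trans KS); rewrite nh; lra.
have [|m mn|z zphi yz] := IH y _ yphi S0 KS.
- by apply: le_trans an; rewrite nh; lra.
- by apply: sS; rewrite ltnW.
exists z => // i; rewrite big_ord_recr /=.
have e1 := yz i; have e2 := xy i.
set A := \sum_(m < n) _ in e1 *; set B := s n * _ in e2 *.
have -> : z ord0 i - x ord0 i - (A + B) =
  (z ord0 i - y ord0 i - A) + (y ord0 i - x ord0 i - B) by ring.
have e3 : C * s n ^+ 2 <= C * S ^+ 2.
  rewrite ler_wpM2l// -[s n ^+ 2]real_normK ?num_real//.
  by rewrite lerXn2r ?nnegrE// sS.
apply: (le_trans (ler_normD _ _)).
have -> : n.+1%:R * (C * S ^+ 2) = n%:R * (C * S ^+ 2) + C * S ^+ 2.
  by rewrite -natr1 mulrDl mul1r.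
by lra.
Qed.

Context (B : R) (B0 : 0 <= B).
Context (span : forall (x h r : R) (rho : 'rV[R]_d), 0 < h -> h <= 1 -> 0 <= x ->
    x + d%:R * h <= 1 -> (forall i, `|rho ord0 i| <= r) ->
  exists2 s : nat -> R, forall m, (m < d)%N -> `|s m| <= B * r / h ^+ d &
    forall i, `|\sum_(m < d) s m *
        (F (x + m.+1%:R * h) ord0 i - F (x + m%:R * h) ord0 i)
      - rho ord0 i| <= B * h * r).

(** The displacement to be produced is [x1 - x]. At the price of [d * h] in level, the distance to
    [x1] passes from [r] to the spanning error plus the accumulated transport errors. *)
Lemma approach (x1 x : 'rV[R]_d) (b h r : R) : 0 < h -> h <= 1 -> 0 <= b ->
  b + d%:R * h <= 1 -> b + d%:R * h < phi x -> 0 <= r ->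
  (forall i, `|x1 ord0 i - x ord0 i| <= r) -> K * (B * r / h ^+ d) <= h ->
  exists2 z, b < phi z & forall i, `|x1 ord0 i - z ord0 i| <=
    B * h * r + d%:R * (C * (B * r / h ^+ d) ^+ 2).
Proof.
move=> h0 h1 b0 bh bphi r0 xr KS.
have rr i : `|(x1 - x) ord0 i| <= r by rewrite !mxE.
have [s sS srho] := span h0 h1 b0 bh rr.
have S0 : 0 <= B * r / h ^+ d.
  by rewrite divr_ge0 ?exprn_ge0 ?(ltW h0)// mulr_ge0.
have [z zphi xz] := transport_chain b0 (ltW h0) bh bphi S0 KS sS.
exists z => // i; have e1 := srho i; have e2 := xz i.
set A := \sum_(m < d) _ in e1 e2; rewrite !mxE in e1.
have -> : x1 ord0 i - z ord0 i =
  - ((z ord0 i - x ord0 i - A) + (A - (x1 ord0 i - x ord0 i))) by ring.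
rewrite normrN; apply: (le_trans (ler_normD _ _)); lra.
Qed.

Context (phi01 : forall x, 0 <= phi x <= 1).
Context (cphi : continuous phi).

(** Halving the scale [D] of the excess level must shrink the admissible distance [c * D ^ (2 d)] by
    the factor [4 ^ d]. With step [h = h0 * D], both errors of [approach] are multiples of that
    distance; [h0], then [c], make each multiple at most half of [4 ^- d]. *)
Lemma oscillation_bound : (0 < d)%N -> exists2 c : R, 0 < c &
  forall x1 x2 (r : R), (forall i, `|x1 ord0 i - x2 ord0 i| <= r) ->
    0 < phi x2 - phi x1 -> c * (phi x2 - phi x1) ^+ (2 * d) < r.
Proof.
move=> d0.
have dR : (1 : R) <= d%:R by rewrite ler1n.
have d4 : (1 : R) <= 4 ^+ d by rewrite exprn_ege1// ler1n.
(* Meets two demands: a loss of level [d * h0 * D <= D / 8], and [B * h0] at most half of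
   [4 ^- d]. *)
pose h0 : R := (8 * d%:R * 4 ^+ d * (B + 1))^-1.
have P1 : 1 <= 8 * d%:R * 4 ^+ d * (B + 1).
  by rewrite -[leLHS]mulr1 ler_pM ?ler01 ?lerDr// -[leLHS]mulr1 ler_pM//
    -[leLHS]mulr1 ler_pM// ler1n.
have h00 : 0 < h0 by rewrite invr_gt0 (lt_le_trans ltr01).
have h01 : h0 <= 1 by rewrite invf_le1// (lt_le_trans ltr01).
have P0 : 0 < 8 * d%:R * 4 ^+ d * (B + 1) by exact: lt_le_trans ltr01 P1.
have dh0 : d%:R * h0 <= 8^-1.
  rewrite ler_pdivrMr// [leRHS](_ : _ = d%:R * (4 ^+ d * (B + 1))); last by field.
  by rewrite ler_peMr// -[leLHS]mulr1 ler_pM// lerDr.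
have Bh0 : B * h0 <= (4 ^+ d)^-1 / 2.
  rewrite ler_pdivrMr// [leRHS](_ : _ = 4 * (d%:R * (B + 1))); last first.
    by field; rewrite expf_neq0.
  have : B + 1 <= d%:R * (B + 1) by rewrite ler_peMl// addr_ge0.
  by have := B0; lra.
(* [X] gathers the constants of the transport error and of the constraint on durations; [c] is set
   so that [X * c] is [h0 ^ (2 d)] times half of [4 ^- d], which serves both. *)
pose X := C * d%:R * B ^+ 2 + K * B + 1.
have X1 : 1 <= X.
  by rewrite /X lerDr addr_ge0// mulr_ge0// ?sqr_ge0// mulr_ge0.
pose c := h0 ^+ (2 * d) * (4 ^+ d)^-1 / (2 * X).
have c0 : 0 < c.
  by rewrite divr_gt0 ?mulr_gt0 ?exprn_gt0 ?invr_gt0// (lt_le_trans ltr01).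
have X0 : 0 < X by exact: lt_le_trans ltr01 X1.
have h2d : 0 < h0 ^+ (2 * d) by rewrite exprn_gt0.
have cX : X * c = h0 ^+ (2 * d) * ((4 ^+ d)^-1 / 2).
  by rewrite /c; field; rewrite expf_neq0//= gt_eqF.
have d4i : (4 ^+ d)^-1 / 2 <= 1 :> R.
  have : (4 ^+ d)^-1 <= 1 :> R by rewrite invf_le1// (lt_le_trans ltr01).
  by lra.
have cXh : X * c <= h0 ^+ (2 * d) by rewrite cX ler_piMr// ltW.
have c1 : c <= 1.
  apply: (@le_trans _ _ (X * c)); first by rewrite ler_peMl// ltW.
  by apply: (le_trans cXh); rewrite exprn_ile1// ltW.
have KB0 : 0 <= K * B by exact: mulr_ge0.
have CB0 : 0 <= C * d%:R * B ^+ 2 by rewrite mulr_ge0 ?sqr_ge0// mulr_ge0.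
(* The constraint [K * S <= h] of a step once powers of [D] are removed; it rests on
   [d + 1 <= 2 d]. *)
have KBc : K * B * c <= h0 ^+ d.+1.
  apply: (@le_trans _ _ (X * c)).
    by rewrite ler_wpM2r ?(ltW c0)// /X; lra.
  apply: (le_trans cXh); rewrite ler_wiXn2l ?(ltW h00)//.
  by rewrite mul2n -addnn -addn1 leq_add2l.
have CBc : C * d%:R * B ^+ 2 * c / h0 ^+ (2 * d) <= (4 ^+ d)^-1 / 2.
  rewrite ler_pdivrMr// [leRHS]mulrC -cX ler_wpM2r ?(ltW c0)// /X.
  by lra.
clear cX cXh; clearbody c; clear P1 P0; clearbody h0.
exists c => // x1 x2 r xr del0; rewrite ltNge; apply/negP => rc.
set a := phi x1 in del0 rc *; set del := phi x2 - a in del0 rc *.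
have /andP[a0 a1] : 0 <= a <= 1 := phi01 x1.
have adel : a + del <= 1 by rewrite /del addrC subrK; have /andP[] := phi01 x2.
(* Of the excess [D / 4] over [a + del / 2], a round spends at most [D / 8]; what remains is the
   same quarter for [D / 2]. *)
have main k : exists2 z, a + del / 2 + del / 2 ^+ k / 4 < phi z &
    forall i, `|x1 ord0 i - z ord0 i| <= c * (del / 2 ^+ k) ^+ (2 * d).
  elim: k => [|k [x xphi xx1]].
    exists x2; last by move=> i; rewrite expr0 divr1; exact: le_trans (xr i) rc.
    have -> : phi x2 = a + del by rewrite /del addrC subrK.
    by rewrite expr0 divr1; lra.
  set D := del / 2 ^+ k in xphi xx1 *.
  have D0 : 0 < D by rewrite divr_gt0// exprn_gt0.
  have Ddel : D <= del.
    by rewrite ler_pdivrMr ?exprn_gt0// ler_peMr ?(ltW del0)// exprn_ege1// ler1n.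
  have D1 : D <= 1 by apply: (le_trans Ddel); lra.
  have DS : del / 2 ^+ k.+1 = D / 2 by rewrite exprS invfM mulrCA mulrC -mulrA.
  clearbody D.
  have hD0 : 0 < h0 * D by rewrite mulr_gt0.
  have hD1 : h0 * D <= 1 by apply: mulr_ile1 => //; exact: ltW.
  have dhD : d%:R * (h0 * D) <= D / 8.
    by rewrite mulrA [X in _ <= X]mulrC ler_wpM2r ?(ltW D0).
  have r0 : 0 <= c * D ^+ (2 * d) by apply: mulr_ge0; [exact: ltW|apply: exprn_ge0;
    exact: ltW].
  have D2d : D ^+ (2 * d) = D ^+ d * D ^+ d by rewrite mul2n -addnn exprD.
  have Ddn0 : D ^+ d != 0 by rewrite expf_neq0// gt_eqF.
  have hdn0 : h0 ^+ d != 0 by rewrite expf_neq0// gt_eqF.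
  have SE : B * (c * D ^+ (2 * d)) / (h0 * D) ^+ d = B * c * D ^+ d / h0 ^+ d.
    rewrite D2d (exprMn _ h0 D); move: (D ^+ d) (h0 ^+ d) Ddn0 hdn0 => Dd hd Dn hn.
    by field; rewrite Dn hn.
  have [||||z zphi zx1] := @approach x1 x (a + del / 2 + D / 8) (h0 * D) (c * D ^+ (2
    * d)) hD0 hD1 _ _ _ r0 xx1.
  - by lra.
  - by lra.
  - by apply: le_lt_trans xphi; lra.
  - rewrite SE !mulrA ler_pdivrMr ?exprn_gt0//.
    have DD : D ^+ d <= D by rewrite -[leRHS]expr1 ler_wiXn2l// ltW.
    apply: (@le_trans _ _ (h0 ^+ d.+1 * D)); last by rewrite exprS le_eqVlt;
      apply/orP; left; apply/eqP; ring.
    by apply: ler_pM => //; [rewrite !mulr_ge0// ltW|exact: exprn_ge0 (ltW D0)].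
  exists z; first by rewrite DS; move: zphi; rewrite (_ : D / 2 / 4 = D / 8)//; field.
  move=> i; apply: (le_trans (zx1 i)); rewrite SE DS.
  have -> : B * (h0 * D) * (c * D ^+ (2 * d)) + d%:R * (C * (B * c * D ^+ d / h0 ^+
    d) ^+ 2) =
     c * D ^+ (2 * d) * (B * h0 * D + C * d%:R * B ^+ 2 * c / h0 ^+ (2 * d)).
    have -> : h0 ^+ (2 * d) = h0 ^+ d * h0 ^+ d by rewrite mul2n -addnn exprD.
    by rewrite D2d; field; exact: hdn0.
  have -> : c * (D / 2) ^+ (2 * d) = c * D ^+ (2 * d) * (4 ^+ d)^-1.
    by rewrite exprMn exprVn [2 ^+ (2 * d)]exprM -[2 ^+ 2]/(2 * 2) (_ : 2 * 2 = 4 :>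
      R) ?mulrA//; ring.
  rewrite ler_wpM2l//.
  have BhD : B * h0 * D <= (4 ^+ d)^-1 / 2.
    by apply: le_trans Bh0; rewrite ler_piMr// mulr_ge0// ltW.
  by lra.
have : nbhs x1 [set z | phi z < a + del / 2].
  by apply: (cvgr_lt (phi x1) (@cphi x1)); rewrite -/a; lra.
move=> /nbhs_ballP[e /= e0 He].
have [k ke] : exists k : nat, (2 ^+ k)^-1 < e.
  have [k _ H] := near_infty_natSinv_expn_lt (PosNum e0).
  by exists k; have := H k (leqnn _); rewrite /= div1r.
have [z zphi zx1] := main k.
have : phi z < a + del / 2.
  apply: He; split => // i j; rewrite !ord1 -ball_normE /ball_/=.
  apply: le_lt_trans (zx1 j) _; apply: le_lt_trans ke.
  have k0 : 0 < (2 ^+ k : R) by rewrite exprn_gt0.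
  have k1 : (1 : R) <= 2 ^+ k by rewrite exprn_ege1// ler1n.
  have dk0 : 0 <= del / 2 ^+ k by rewrite divr_ge0 ?(ltW del0)// ltW.
  have del1 : del <= 1 by lra.
  have dk : del / 2 ^+ k <= (2 ^+ k)^-1 by rewrite ler_piMl// invr_ge0 ltW.
  apply: le_trans dk; rewrite -[leRHS]mul1r ler_pM ?(ltW c0) ?exprn_ge0//.
  rewrite -[leRHS]expr1 ler_wiXn2l//; last by rewrite muln_gt0.
  by rewrite ler_pdivrMr// mul1r (le_trans del1).
have := divr_gt0 del0 (exprn_gt0 k (ltr0Sn R 1)).
by move: zphi; lra.
Qed.

End fixed_time.
End iteration.

Lemma coord_le_norm (R : realType) (d : nat) (x : 'rV[R]_d) i : `|x ord0 i| <= `|x|.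
Proof.
rewrite [leRHS]/Num.Def.normr/= mx_normrE.
exact: (le_bigmax _ (fun p : 'I_1 * 'I_d => `|x p.1 p.2|) (ord0, i)).
Qed.

Theorem theorem4 (R : realType) (d : nat) (f : R -> 'rV[R]_d)
    (g u : R * 'rV[R]_d -> R) :
  (1 <= d)%N ->
  Ck_in unit_interval d.+2 f ->
  (forall v : R, 0 <= v <= 1 ->
    <<[seq derive1n_in unit_interval j f v | j <- iota 2 d]>>%VS = fullv) ->
  g \in Lfun (lebesgue_spacetime R d) +oo%E ->
  continuous u ->
  (forall z, 0 <= u z <= 1) ->
  distributional_solution f g u ->
  isentropic f g u ->
  forall t : R, holder_continuous (2 * d%:R)^-1 (fun x => u (t, x)).
Proof.
move=> d0 fC fspan gL cu u01 _ isen t.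
have [G [g' [G0 mg mg' bg' gg']]] := Lfun_oo_bounded gL.
pose F := derive1n_in unit_interval 1 f \o clamp 0 1.
have cF : continuous F by apply: within_continuous_clamp; exact: fC.2.
have fF v : 0 <= v <= 1 -> derive1_in unit_interval f v = F v.
  by move=> v01; rewrite /F /= clamp_in.
have kin := isentropic_kinetic isen cu u01 cF fF mg mg' bg' gg'.
have [L L0 cL] := cderiv_lipschitz fC.
have FL v w i : 0 <= v <= 1 -> 0 <= w <= 1 ->
    `|F v ord0 i - F w ord0 i| <= L * `|v - w|.
  by move=> v01 w01; exact: (cL 1%N i v w).
have tr := kinetic_transport kin G0 bg' cu u01 L0 FL.
have K0 : 0 < 16 * G by rewrite mulr_gt0.
have st := transport_step K0 L0 FL tr.
have [B B0 span] := increments_almost_span fC fspan.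
have C0 : 0 <= 2 * (16 * G * L + 1) + L * (16 * G).
  have := mulr_ge0 (ltW K0) L0; clear; lra.
have K20 : 0 <= 2 * (16 * G) by rewrite mulr_ge0// ltW.
have cphi : continuous (fun x => u (t, x)).
  move=> x; apply: (@continuous_comp _ _ _ (fun y => (t, y)) u); last exact: cu.
  exact: (@cvg_pair _ _ _ (nbhs x) (nbhs t) (nbhs x) _ _ _ (fun=> t) id (cvg_cst t)
    cvg_id).
have [c c0 osc] := oscillation_bound K20 C0 (fun x w' w'' s => st t x w' w'' s)
  B0 span (fun x => u01 (t, x)) cphi d0.
have dR : (0 : R) < 2 * d%:R by rewrite mulr_gt0// ltr0n.
have gam0 : 0 <= (2 * d%:R)^-1 :> R by rewrite invr_ge0 ltW.
(* Inverting [c * del ^ (2 d) < |x - y|] yields the exponent and this constant. *)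
exists ((c^-1) `^ (2 * d%:R)^-1).
have main x y : 0 < u (t, y) - u (t, x) ->
    u (t, y) - u (t, x) <= c^-1 `^ (2 * d%:R)^-1 * `|x - y| `^ (2 * d%:R)^-1.
  set del := u (t, y) - u (t, x) => del0.
  have H : c * del ^+ (2 * d) < `|x - y|.
    apply: (osc x y `|x - y| _ del0) => i.
    by have := coord_le_norm (x - y) i; rewrite !mxE.
  rewrite -powRM ?invr_ge0 ?(ltW c0)//.
  have -> : del = (del ^+ (2 * d)) `^ (2 * d%:R)^-1.
    rewrite -powR_mulrn ?(ltW del0)// -powRrM natrM mulfV ?gt_eqF//.
    by rewrite powRr1// ltW.
  apply: ge0_ler_powR => //.
  - by rewrite nnegrE exprn_ge0// ltW.
  - by rewrite nnegrE mulr_ge0// invr_ge0 ltW.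
  - by rewrite ler_pdivlMl// ltW.
move=> x y.
have [E|xy|yx] := ltgtP (u (t, x)) (u (t, y)).
- by rewrite ltr0_norm ?subr_lt0// opprB main// subr_gt0.
- by rewrite gtr0_norm ?subr_gt0// distrC main// subr_gt0.
- by rewrite yx subrr normr0 mulr_ge0// powR_ge0.
Qed.
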